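(* Let $n\ge2$, let $0<\alpha<1$, and let $u$ be a homogeneous order $\alpha$ viscosity solution of a uniformly elliptic Hessian equation $F(D^2u)=0$ in the punctured ball $B^o\subset\mathbf{R}^n$. Then $u=c|x|^{\alpha}$ for some constant $c$.
   Context: $B^o=\{x\in\mathbf{R}^n:0<|x|<1\}$. Homogeneous of order $\alpha$ means $u(tx)=t^\alpha u(x)$ for all $t>0$ and $x$ with $x,tx\in B^o$. $S^2(\mathbf{R}^n)$ is the space of real symmetric $n\times n$ matrices. $F:S^2(\mathbf{R}^n)\to\mathbf{R}$ is a Lipschitz function; it is uniformly elliptic if there is a constant $C\ge1$ such that $C^{-1}\|N\|\le F(M+N)-F(M)\le C\|N\|$ for all $M\in S^2(\mathbf{R}^n)$ and all non-negative definite $N\in S^2(\mathbf{R}^n)$. The equation $F(D^2u)=0$ is called Hessian if $F(S)$ depends only on the eigenvalues of $S$, equivalently $F({}^tO\,S\,O)=F(S)$ for all $O\in O(n)$. A continuous function $u$ on an open set $\Omega$ is a viscosity solution of $F(D^2u)=0$ in $\Omega$ if for every $x_0\in\Omega$ and every $C^2$ function $\varphi$ near $x_0$: $F(D^2\varphi(x_0))\ge0$ whenever $u-\varphi$ has a local maximum at $x_0$, and $F(D^2\varphi(x_0))\le0$ whenever $u-\varphi$ has a local minimum at $x_0$. *)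

(* Defs.v *)
From HB Require Import structures.
From mathcomp Require Import all_boot all_order all_algebra.
From mathcomp Require Import all_classical all_reals all_analysis.
Set Implicit Arguments.
Unset Strict Implicit.
Unset Printing Implicit Defensive.
Import Order.TTheory GRing.Theory Num.Theory.
Import numFieldNormedType.Exports.
Local Open Scope classical_set_scope.
Local Open Scope ring_scope.

(* Points of R^n are row vectors 'rV[R]_n.  Pitfall: the library norm `|x| on
   matrices is the maximum of the absolute values of the entries, hence the
   explicit Euclidean norm below. *)
Definition euclid_norm (R : realType) (n : nat) (x : 'rV[R]_n) : R :=
  Num.sqrt (\sum_i x 0 i ^+ 2).

Definition punctured_ball (R : realType) (n : nat) : set 'rV[R]_n :=
  [set x | 0 < euclid_norm x < 1].

Definition symmetric_matrices (R : realType) (n : nat) : set 'M[R]_n :=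
  [set S | S^T = S].

Definition nonneg_definite (R : realType) (n : nat) (N : 'M[R]_n) : Prop :=
  N^T = N /\ forall v : 'rV[R]_n, 0 <= (v *m N *m v^T) 0 0.

(* A function on the space of symmetric matrices is represented by a function
   on all square matrices whose values off the symmetric ones are never
   constrained nor used. *)

(* `|N| is the max-entry norm; as all norms on matrices are equivalent and C is
   existentially quantified, the choice of norm is immaterial. *)
Definition uniformly_elliptic (R : realType) (n : nat) (F : 'M[R]_n -> R) :
    Prop :=
  exists2 C : R, 1 <= C &
    forall M N : 'M[R]_n, symmetric_matrices M -> nonneg_definite N ->
      C^-1 * `|N| <= F (M + N) - F M <= C * `|N|.

Definition hessian_equation (R : realType) (n : nat) (F : 'M[R]_n -> R) :
    Prop :=
  forall S O : 'M[R]_n, symmetric_matrices S -> O^T *m O = 1%:M ->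
    F (O^T *m S *m O) = F S.

Definition partial (R : realType) (n : nat) (i : 'I_n) (f : 'rV[R]_n -> R) :
    'rV[R]_n -> R :=
  'D_(delta_mx 0 i) f.

(* Derivatives are total in the library (with a default value where the limit
   does not exist), so existence is required separately. *)
Definition C1_at (R : realType) (n : nat) (f : 'rV[R]_n -> R) (x : 'rV[R]_n) :
    Prop :=
  {for x, continuous f} /\
  forall i : 'I_n, derivable f x (delta_mx 0 i) /\
                   {for x, continuous (partial i f)}.

Definition C2_near (R : realType) (n : nat) (f : 'rV[R]_n -> R)
    (x0 : 'rV[R]_n) : Prop :=
  \forall x \near x0, C1_at f x /\ forall i : 'I_n, C1_at (partial i f) x.

Definition hessian (R : realType) (n : nat) (f : 'rV[R]_n -> R)
    (x : 'rV[R]_n) : 'M[R]_n :=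
  \matrix_(i, j) partial j (partial i f) x.

Definition local_max (R : realType) (n : nat) (g : 'rV[R]_n -> R)
    (x0 : 'rV[R]_n) : Prop :=
  \forall x \near x0, g x <= g x0.

Definition local_min (R : realType) (n : nat) (g : 'rV[R]_n -> R)
    (x0 : 'rV[R]_n) : Prop :=
  \forall x \near x0, g x0 <= g x.

(* Meaningful for Omega open: only the values of u on Omega then matter. *)
Definition viscosity_solution (R : realType) (n : nat) (F : 'M[R]_n -> R)
    (Omega : set 'rV[R]_n) (u : 'rV[R]_n -> R) : Prop :=
  {within Omega, continuous u} /\
  forall (x0 : 'rV[R]_n) (phi : 'rV[R]_n -> R),
    Omega x0 -> C2_near phi x0 ->
    (local_max (fun x => u x - phi x) x0 -> 0 <= F (hessian phi x0)) /\
    (local_min (fun x => u x - phi x) x0 -> F (hessian phi x0) <= 0).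

Definition homogeneous_in_ball (R : realType) (n : nat) (alpha : R)
    (u : 'rV[R]_n -> R) : Prop :=
  forall (t : R) (x : 'rV[R]_n), 0 < t ->
    punctured_ball x -> punctured_ball (t *: x) ->
    u (t *: x) = t `^ alpha * u x.

(* Main.v *)
(** The difference [w = u - u o rho] of [u] and its reflection in a hyperplane
   orthogonal to [e] is, at the level of touching Hessians, a solution of a
   linear elliptic equation; it vanishes on the hyperplane and is homogeneous
   of order [alpha < 1].  For small [delta] the function
   [(x.e + delta |x|)^alpha] is positive, homogeneous of order [alpha] and a
   strict supersolution in the closed half-space minus the origin, because of
   the concavity of [t^alpha].  If [w] were positive somewhere in the
   half-space, the least multiple of this barrier above [w] would touch [w] at
   an interior point, which ellipticity forbids.  Hence [w <= 0] for every [e],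
   and [u] is radial.

   Touching a difference of two viscosity solutions requires the theorem on
   sums: if [u1 + u2] has a strict maximum, then there are touching Hessians
   [S1], [S2] of [u1], [u2] with [S1 + S2 <= 0].  It is proved here without
   measure theory.  After sup-convolution both functions are semiconvex, so
   they are [C^{1,1}] at the points where [u1 + u2 - q.x] is maximal for small
   [q], and the sum of their gradients maps these points Lipschitz-continuously
   onto a ball of slopes.  By counting in m-adic cubes, at some small scale the
   contact points meet all subcubes of a cube.  Blowing up there gives entire
   [C^{1,1}] functions with concave sum and the same touching Hessians.  A
   further blow-up of extremal slope makes one component of a gradient linear
   (McShane); treating all components in turn leaves two quadratic
   polynomials. *)

Require Import Defs.
From HB Require Import structures.
From mathcomp Require Import all_boot all_order all_algebra.
From mathcomp Require Import all_classical all_reals all_analysis.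
From mathcomp Require Import ring lra zify.
Import Order.TTheory GRing.Theory Num.Theory.
Import numFieldNormedType.Exports.
Local Open Scope classical_set_scope.
Local Open Scope ring_scope.
Set Implicit Arguments.
Unset Strict Implicit.
Unset Printing Implicit Defensive.

(** * Inner products, quadratic forms and limits along ultrafilters *)

(* Type class resolution does not find the filter structure of [nbhs y] when
   [y] is a row vector of variable length. *)
#[global] Instance nbhs_rV_filter (R : realType) (n : nat) (y : 'rV[R]_n) :
  ProperFilter (nbhs y).
Proof. exact: nbhs_pfilter. Qed.

Section Dot.
Context {R : realType} {n : nat}.
Implicit Types (x y z : 'rV[R]_n) (S T : 'M[R]_n).

Definition dot x y : R := (x *m y^T) 0 0.
Definition qf S x : R := (x *m S *m x^T) 0 0.

Lemma dotE x y : dot x y = \sum_i x 0 i * y 0 i.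
Proof. by rewrite /dot mxE; apply: eq_bigr => i _; rewrite mxE. Qed.

Lemma dotC x y : dot x y = dot y x.
Proof. by rewrite !dotE; apply: eq_bigr => i _; rewrite mulrC. Qed.

Lemma dotDl x y z : dot (x + y) z = dot x z + dot y z.
Proof. by rewrite /dot mulmxDl mxE. Qed.

Lemma dotZl a x y : dot (a *: x) y = a * dot x y.
Proof. by rewrite /dot -scalemxAl mxE. Qed.

Lemma dotNl x y : dot (- x) y = - dot x y.
Proof. by rewrite /dot mulNmx mxE. Qed.

Lemma dot0l x : dot 0 x = 0.
Proof. by rewrite /dot mul0mx mxE. Qed.

Lemma dotDr x y z : dot x (y + z) = dot x y + dot x z.
Proof. by rewrite dotC dotDl !(dotC x). Qed.

Lemma dotZr a x y : dot x (a *: y) = a * dot x y.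
Proof. by rewrite dotC dotZl dotC. Qed.

Lemma dotNr x y : dot x (- y) = - dot x y.
Proof. by rewrite dotC dotNl dotC. Qed.

Lemma dot0r x : dot x 0 = 0.
Proof. by rewrite dotC dot0l. Qed.

Definition dotL := (dotDl, dotDr, dotNl, dotNr, dotZl, dotZr, dot0l, dot0r).

Lemma dot_ge0 x : 0 <= dot x x.
Proof. by rewrite dotE; apply: sumr_ge0 => i _; exact: sqr_ge0. Qed.

Lemma dot_eq0 x : dot x x = 0 -> x = 0.
Proof.
rewrite dotE => /eqP; rewrite psumr_eq0; last by move=> i _; exact: sqr_ge0.
move=> /allP h; apply/rowP => i; rewrite mxE; apply/eqP.
by have := h i (mem_index_enum _); rewrite mulf_eq0 orbb.
Qed.

Lemma dot_delta x i : dot x (delta_mx 0 i) = x 0 i.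
Proof.
rewrite dotE (bigD1 i)//= mxE !eqxx mulr1 big1 ?addr0// => j ji.
by rewrite mxE (negbTE ji) andbF mulr0.
Qed.

Lemma le_coord_norm x i : `|x 0 i| <= `|x|.
Proof.
rewrite [leRHS]/Num.norm /= mx_normrE.
by apply/bigmax_geP; right => /=; exists (0, i).
Qed.

Lemma norm_coord_le x r : 0 <= r -> (forall i, `|x 0 i| <= r) -> `|x| <= r.
Proof.
move=> r0 h; rewrite [leLHS]/Num.norm /= mx_normrE.
by apply/bigmax_leP; split => // -[i j] _ /=; rewrite (ord1 i).
Qed.

Lemma norm_coord_lt x r : 0 < r -> (forall i, `|x 0 i| < r) -> `|x| < r.
Proof.
move=> r0 h; rewrite [ltLHS]/Num.norm /= mx_normrE.
by apply/bigmax_ltP; split => // -[i j] _ /=; rewrite (ord1 i).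
Qed.

Lemma dot_le_norm x y : `|dot x y| <= n%:R * (`|x| * `|y|).
Proof.
rewrite dotE (le_trans (ler_norm_sum _ _ _))//.
rewrite -[X in X%:R * _](card_ord n) -sum1_card natr_sum mulr_suml.
apply: ler_sum => i _; rewrite mul1r normrM.
by apply: ler_pM => //; exact: le_coord_norm.
Qed.

(** With [norm_sqr_le] this compares the Euclidean norm behind [dot] with the max-entry norm in
    which balls are expressed. *)
Lemma dot_sqr_le x : dot x x <= n%:R * `|x| ^+ 2.
Proof. by rewrite (le_trans (ler_norm _))// (le_trans (dot_le_norm _ _))// expr2. Qed.

Lemma norm_sqr_le x : `|x| ^+ 2 <= dot x x.
Proof.
have [->|x0] := eqVneq x 0; first by rewrite normr0 expr0n dot_ge0.
have : `|x| != 0 by rewrite normr_eq0.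
rewrite {1}/Num.norm /= => /mx_norm_neq0[[i j]] /=.
rewrite (ord1 i) => xE; rewrite [X in X ^+ 2]/Num.norm /= xE.
rewrite -normrX ger0_norm ?sqr_ge0// dotE (bigD1 j)//= -expr2 lerDl.
by apply: sumr_ge0 => k _; exact: sqr_ge0.
Qed.

Lemma norm_delta_le (i : 'I_n) : `|delta_mx 0 i : 'rV[R]_n| <= 1.
Proof.
apply: norm_coord_le => // j; rewrite mxE.
by case: (_ && _); rewrite ?normr1 ?normr0.
Qed.

Lemma dot_delta_delta (i : 'I_n) :
  dot (delta_mx 0 i) (delta_mx 0 i) = 1 :> R.
Proof. by rewrite dot_delta mxE !eqxx. Qed.

Lemma qfDr S x y : S^T = S ->
  qf S (x + y) = qf S x + qf S y + 2 * dot (x *m S) y.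
Proof.
move=> sS; rewrite /qf -/(dot _ _) mulmxDl !dotL /dot.
suff -> : (y *m S *m x^T) 0 0 = (x *m S *m y^T) 0 0 by ring.
transitivity ((y *m S *m x^T)^T 0 0); first by rewrite [RHS]mxE.
by rewrite !trmx_mul trmxK sS mulmxA.
Qed.

Lemma qfZ S a x : qf S (a *: x) = a ^+ 2 * qf S x.
Proof. by rewrite /qf -/(dot _ _) -scalemxAl !dotL /dot; ring. Qed.

Lemma qf0 S : qf S 0 = 0.
Proof. by rewrite /qf !mul0mx mxE. Qed.

Lemma qfDl S T x : qf (S + T) x = qf S x + qf T x.
Proof. by rewrite /qf mulmxDr mulmxDl mxE. Qed.

Lemma qfNl S x : qf (- S) x = - qf S x.
Proof. by rewrite /qf mulmxN mulNmx mxE. Qed.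

Lemma qfZl a S x : qf (a *: S) x = a * qf S x.
Proof. by rewrite /qf -scalemxAr -scalemxAl mxE. Qed.

Lemma qf1 x : qf 1%:M x = dot x x.
Proof. by rewrite /qf mulmx1. Qed.

Lemma qf_conj S (O : 'M[R]_n) x : qf S (x *m O) = qf (O *m S *m O^T) x.
Proof. by rewrite /qf trmx_mul !mulmxA. Qed.

(* This one-sided closedness is all that the limits below need, and follows
   from ellipticity. *)
Definition symmx_closed (A : 'M[R]_n -> Prop) :=
  forall S, S^T = S -> (forall eps : R, 0 < eps -> A (S + eps%:M)) -> A S.

(* [A] plays the role of [{S | 0 <= F S}]: every quadratic polynomial touching
   [u] from above at a point of [D] has its Hessian in [A]. *)
Definition subsol (A : 'M[R]_n -> Prop) (D : set 'rV[R]_n) (u : 'rV[R]_n -> R) :=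
  forall x p S r, D x -> 0 < r -> S^T = S ->
    (forall y, `|y - x| < r ->
      u y <= u x + dot p (y - x) + 2^-1 * qf S (y - x)) -> A S.

End Dot.

Section Cvg.
Context {R : realType} {n : nat} {I : Type} (F : set_system I) {FF : Filter F}.

Lemma cvg_rV (f : I -> 'rV[R]_n) (x : 'rV[R]_n) :
  (forall i, (fun k => f k 0 i) @ F --> (x 0 i : R)) -> f @ F --> x.
Proof.
move=> h; apply/cvgrPdist_lt => e e0.
have : \forall k \near F, forall i, `|x 0 i - f k 0 i| < e.
  apply: filter_forall => i.
  by move/cvgrPdist_lt : (h i) => /(_ _ e0).
apply: filterS => k hk; apply: norm_coord_lt => // i.
by rewrite !mxE; exact: hk.
Qed.

Lemma cvg_coord (f : I -> 'rV[R]_n) (x : 'rV[R]_n) i :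
  f @ F --> x -> (fun k => f k 0 i) @ F --> (x 0 i : R).
Proof.
move=> fx; apply: (@cvg_comp _ _ _ f (fun y : 'rV[R]_n => y 0 i)) fx _.
exact: coord_continuous.
Qed.

Lemma cvg_dot (f g : I -> 'rV[R]_n) (x y : 'rV[R]_n) : f @ F --> x -> g @ F --> y ->
  (fun k => dot (f k) (g k)) @ F --> dot x y.
Proof.
move=> fx gy; rewrite dotE.
under eq_fun do rewrite dotE.
by apply: cvg_big => [z|i _]; [exact: add_continuous|apply: cvgM; exact: cvg_coord].
Qed.

Lemma cvg_mulmx (f : I -> 'rV[R]_n) (x : 'rV[R]_n) (S : 'M[R]_n) : f @ F --> x ->
  (fun k => f k *m S) @ F --> x *m S.
Proof.
move=> fx; apply: cvg_rV => i; rewrite mxE.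
under eq_fun do rewrite mxE.
apply: cvg_big => [z|j _]; first exact: add_continuous.
by apply: cvgMl; exact: cvg_coord.
Qed.

Lemma cvg_qf (f : I -> 'rV[R]_n) (x : 'rV[R]_n) (S : 'M[R]_n) : f @ F --> x ->
  (fun k => qf S (f k)) @ F --> qf S x.
Proof. by move=> fx; apply: cvg_dot => //; exact: cvg_mulmx. Qed.

End Cvg.

Section UltraLimit.
Context {R : realType} {n : nat} {I : Type} (F : set_system I).
Context {UF : UltraFilter F}.

Lemma ultra_fmap (T : Type) (f : I -> T) : UltraFilter (f @ F).
Proof.
split=> [|G GF FG]; first exact: fmap_proper_filter.
rewrite predeqE => A; split; last exact: FG.
move=> GA; have [//|FnA] := in_ultra_setVsetC (f @^-1` A) UF.
have /filter_ex[x []//] : G (A `&` ~` A) by apply: filterI => //; exact: FG.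
Qed.

(** Every bounded sequence converges along an ultrafilter, so the limits at all points exist along
    one and the same filter and no diagonal subsequence is extracted. *)
Lemma ultra_cvg (f : I -> R) (M : R) : (\forall k \near F, `|f k| <= M) ->
  f @ F --> lim (f @ F).
Proof.
move=> fM; apply/cvg_ex => /=.
have UfF : UltraFilter (f @ F) by exact: ultra_fmap.
have := @segment_compact R (- M) M.
rewrite compact_ultra => /(_ (f @ F) UfF)[|l [_ fl]]; last by exists l.
by apply: filterS fM => k; rewrite /= in_itv /= -ler_norml.
Qed.

Lemma ultra_cvg_rV (f : I -> 'rV[R]_n) (M : R) : (\forall k \near F, `|f k| <= M) ->
  f @ F --> lim (f @ F).
Proof.
move=> fM; apply/cvg_ex; exists (\row_i lim ((fun k => f k 0 i) @ F)).
apply: cvg_rV => i; rewrite mxE; apply: (@ultra_cvg _ M).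
by apply: filterS fM => k; apply: le_trans; exact: le_coord_norm.
Qed.

End UltraLimit.

(** * Functions with quadratic contact *)

Section Box.
Context {R : realType} {n : nat}.
Implicit Types (x y z : 'rV[R]_n).

Lemma compact_box x (rho : R) : compact [set y : 'rV[R]_n | `|y - x| <= rho].
Proof.
apply: bounded_closed_compact.
  exists (rho + `|x|); split; first exact: num_real.
  move=> M hM y /= yx; apply: le_trans (ltW hM).
  by rewrite -[y](subrK x) (le_trans (ler_normD _ _))// lerD2r.
have : closed ((fun y : 'rV[R]_n => `|y - x|) @^-1` [set t : R | t <= rho]).
  apply: closed_comp => [y _|]; last by have := @closed_le R rho.
  have h : (fun y => y - x) @ y --> y - x.
    by apply: cvgB; [exact: cvg_id|exact: cvg_cst].
  exact: (cvg_norm h).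
by [].
Qed.

Lemma box_max x (rho : R) (f : 'rV[R]_n -> R) : 0 <= rho ->
  (forall y, `|y - x| <= rho -> {for y, continuous f}) ->
  exists w, `|w - x| <= rho /\ forall y, `|y - x| <= rho -> f y <= f w.
Proof.
move=> rho0 cf.
have [||w /set_mem /= wx hw] := @compact_EVT_max _ R f _ _ (@compact_box x rho).
- by exists x => /=; rewrite subrr normr0.
- by apply: continuous_in_subspaceT => y /set_mem; exact: cf.
by exists w; split => // y yx; apply: hw; rewrite inE.
Qed.

Lemma quad_continuous (c : R) (p x : 'rV[R]_n) (S : 'M[R]_n) :
  continuous (fun y => c + dot p (y - x) + 2^-1 * qf S (y - x)).
Proof.
move=> y; have h : (fun y => y - x) @ y --> y - x.
  by apply: cvgB; [exact: cvg_id|exact: cvg_cst].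
apply: cvgD; last by apply: cvgMr; exact: cvg_qf.
by apply: cvgD; [exact: cvg_cst|apply: cvg_dot => //; exact: cvg_cst].
Qed.

End Box.

Section Jets.
Context {R : realType} {n : nat} (A : bool -> 'M[R]_n -> Prop) (K : R).
Implicit Types (x y z : 'rV[R]_n) (D Gam : set 'rV[R]_n).
Implicit Types (U : bool -> 'rV[R]_n -> R) (G : bool -> 'rV[R]_n -> 'rV[R]_n).

(* [G] is a gradient of [U] at the points of [Gam] only, with quadratic error
   bounds valid throughout [D]. *)
Record jets D Gam U G : Prop := Jets {
  jets_c11 : forall i y z, Gam y -> D z ->
    `|U i z - U i y - dot (G i y) (z - y)| <= K * dot (z - y) (z - y) ;
  jets_concave : forall y z, Gam y -> D z ->
    U true z + U false z <=
    U true y + U false y + dot (G true y + G false y) (z - y) ;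
  jets_continuous : forall i z, D z -> {for z, continuous (U i)} ;
  jets_subsol : forall i, subsol (A i) D (U i) }.

(** Compare the expansions of [U i] at [x] and at [y] in the test point [y + d e_j]: coordinate [j]
    of the gradient difference, times [d], is a sum of three errors of order [K d^2]. The test point
    need only lie in [D]. *)
Lemma jets_lipschitz D Gam U G i x y (d : R) : 0 <= K -> jets D Gam U G ->
  Gam x -> Gam y -> D y -> `|x - y| <= d -> (forall z, `|z - y| <= d -> D z) ->
  `|G i x - G i y| <= 3 * K * n.+1%:R * d.
Proof.
move=> K0 J Gx Gy Dy xyd Dd.
have d0 : 0 <= d by apply: le_trans xyd.
have [d00|dn0] := eqVneq d 0.
  move: xyd; rewrite d00 normr_le0 subr_eq0 => /eqP ->.
  by rewrite subrr normr0 mulr0.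
have dgt0 : 0 < d by rewrite lt_def dn0.
have n0 : 0 <= n%:R :> R by exact: ler0n.
apply: norm_coord_le => [|j]; first by rewrite !mulr_ge0.
have -> : `|(G i x - G i y) 0 j| =
    d^-1 * `|dot (G i x - G i y) (d *: delta_mx 0 j)|.
  by rewrite dotZr dot_delta normrM gtr0_norm// mulrA mulVf// mul1r.
rewrite ler_pdivrMl// mulrC.
have : `|d *: delta_mx 0 j : 'rV[R]_n| <= d.
  by rewrite normrZ gtr0_norm// ler_piMr// norm_delta_le.
have : dot (d *: delta_mx 0 j : 'rV[R]_n) (d *: delta_mx 0 j) = d ^+ 2.
  by rewrite dotZl dotZr dot_delta_delta mulr1 expr2.
move: (d *: _) => h hh hd.
have Dz : D (y + h) by apply: Dd; rewrite addrAC subrr add0r.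
have h1 := jets_c11 J i Gx Dz.
have h2 := jets_c11 J i Gx Dy.
have h3 : `|U i (y + h) - U i y - dot (G i y) h| <= K * dot h h.
  by have := jets_c11 J i Gy Dz; rewrite [y + h - y]addrAC subrr add0r.
have xy2 : dot (y - x) (y - x) <= n%:R * d ^+ 2.
  apply: le_trans (dot_sqr_le _) _; rewrite ler_wpM2l//.
  by rewrite ler_pXn2r ?nnegrE// distrC.
have zx2 : dot (y + h - x) (y + h - x) <= 2 * dot (y - x) (y - x) + 2 * dot h h.
  have := dot_ge0 (y - x - h).
  by rewrite !dotL (dotC h x) (dotC h y) (dotC y x); lra.
have E : dot (G i x - G i y) h =
   dot (G i x) (y + h - x) - dot (G i x) (y - x) - dot (G i y) h.
  by rewrite !dotL; ring.
have k1 : K * dot (y + h - x) (y + h - x) <= K * (2 * (n%:R * d ^+ 2) + 2 * d ^+ 2).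
  by rewrite ler_wpM2l// (le_trans zx2)// hh; lra.
have k2 : K * dot (y - x) (y - x) <= K * (n%:R * d ^+ 2) by rewrite ler_wpM2l.
have -> : 3 * K * n.+1%:R * d * d =
  K * (2 * (n%:R * d ^+ 2) + 2 * d ^+ 2) + K * (n%:R * d ^+ 2) + K * d ^+ 2.
  by rewrite -natr1; ring.
rewrite E; move: h1 h2 h3; rewrite !ler_norml hh => /andP[? ?] /andP[? ?] /andP[? ?].
by apply/andP; split; lra.
Qed.

(* The rescalings preserve second derivatives, hence the touching Hessians. *)
Definition rsU (m : 'rV[R]_n) (h : R) U G i y : R :=
  (U i (m + h *: y) - U i m - h * dot (G i m) y) / h ^+ 2.
Definition rsG (m : 'rV[R]_n) (h : R) G i y : 'rV[R]_n :=
  h^-1 *: (G i (m + h *: y) - G i m).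

Lemma jets_rescale D Gam U G (m : 'rV[R]_n) (h : R) : 0 < h -> jets D Gam U G ->
  jets [set y | D (m + h *: y)] [set y | Gam (m + h *: y)]
    (rsU m h U G) (rsG m h G).
Proof.
move=> h0 J; have hn0 : h != 0 by rewrite gt_eqF.
have E y z : m + h *: z - (m + h *: y) = h *: (z - y).
  by rewrite opprD addrACA subrr add0r scalerBr.
split.
- move=> i y z /= Gy Dz; have H := jets_c11 J i Gy Dz.
  rewrite E !dotZr !dotZl in H.
  have -> : rsU m h U G i z - rsU m h U G i y - dot (rsG m h G i y) (z - y) =
    h ^- 2 * (U i (m + h *: z) - U i (m + h *: y) -
              h * dot (G i (m + h *: y)) (z - y)).
    by rewrite /rsU /rsG !dotL; field.
  rewrite normrM gtr0_norm ?invr_gt0 ?exprn_gt0// ler_pdivrMl ?exprn_gt0//.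
  by apply: le_trans H _; rewrite le_eqVlt; apply/orP; left; apply/eqP; ring.
- move=> y z /= Gy Dz; have H := jets_concave J Gy Dz.
  rewrite E !dotZr in H.
  rewrite -subr_ge0.
  have -> : rsU m h U G true y + rsU m h U G false y +
    dot (rsG m h G true y + rsG m h G false y) (z - y) -
    (rsU m h U G true z + rsU m h U G false z) =
    h ^- 2 * (U true (m + h *: y) + U false (m + h *: y) +
    h * dot (G true (m + h *: y) + G false (m + h *: y)) (z - y) -
    (U true (m + h *: z) + U false (m + h *: z))).
    by rewrite /rsU /rsG !dotL; field.
  by rewrite mulr_ge0 ?invr_ge0 ?exprn_ge0 ?subr_ge0// ltW.
- move=> i z /= Dz; apply: cvgMl; apply: cvgB.
    apply: cvgB; last exact: cvg_cst.
    have hz : (fun y => m + h *: y) @ z --> m + h *: z.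
      by apply: cvgD; [exact: cvg_cst|apply: cvgZr; exact: cvg_id].
    apply: (@cvg_comp _ _ _ (fun y => m + h *: y) (U i)) hz _.
    exact: (jets_continuous J Dz).
  by apply: cvgMr; apply: cvg_dot; [exact: cvg_cst|exact: cvg_id].
- move=> i x p S r /= Dx r0 sS H.
  have HS : subsol (A i) D (U i) by exact: (jets_subsol J).
  (* The affine part removed in [rsU] reappears in the slope; the Hessian [S] is unchanged. *)
  apply: (HS (m + h *: x) (h *: p + G i m) S (h * r) Dx _ sS) => [|y hy].
    exact: mulr_gt0.
  pose y' := h^-1 *: (y - m).
  have yE : y = m + h *: y' by rewrite /y' scalerA divff// scale1r addrC subrK.
  have : `|y' - x| < r.
    rewrite -(ltr_pM2l h0) -[X in X * `|_|](gtr0_norm h0) -normrZ.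
    by rewrite -E -yE.
  move=> /H; rewrite yE E dotZr qfZ dotDl dotZl /rsU -subr_ge0 => H'.
  rewrite -subr_ge0.
  have := mulr_ge0 (sqr_ge0 h) H'; congr (0 <= _).
  by rewrite !dotL; field.
Qed.

End Jets.

Section Squeeze.
Context {R : realType} {n : nat} {I : Type} (F : set_system I) {FF : Filter F}.

Lemma cvg0_le (f g : I -> R) : (\forall k \near F, `|f k| <= g k) ->
  g @ F --> 0 -> f @ F --> 0.
Proof.
move=> fg g0; apply/cvgrPdist_lt => e e0.
move/cvgrPdist_lt : g0 => /(_ e e0); apply: filterS2 fg => k fgk.
rewrite !sub0r !normrN; apply: le_lt_trans.
by rewrite (le_trans fgk)// ler_norm.
Qed.

Lemma cvg_near_ball (f : I -> 'rV[R]_n) (x : 'rV[R]_n) (e : R) : 0 < e ->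
  f @ F --> x -> \forall k \near F, `|f k - x| < e.
Proof.
move=> e0 /cvgrPdist_lt /(_ e e0); apply: filterS => k.
by rewrite distrC.
Qed.

Lemma cvg_subr (f g : I -> 'rV[R]_n) (x y : 'rV[R]_n) : f @ F --> x -> g @ F --> y ->
  (fun k => f k - g k) @ F --> x - y.
Proof. by move=> fx gy; apply: cvgB. Qed.

Lemma cvg_dot0 (f g : I -> 'rV[R]_n) (x : 'rV[R]_n) (K : R) :
  f @ F --> x -> g @ F --> x ->
  (fun k => K * dot (f k - g k) (f k - g k)) @ F --> (0 : R).
Proof.
move=> fx gx; have h := cvg_subr fx gx.
have -> : 0 = K * dot (x - x) (x - x) :> R by rewrite subrr dot0l mulr0.
by apply: cvgMr; exact: cvg_dot.
Qed.

End Squeeze.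

Lemma c11_continuous (R : realType) (n : nat) (K : R) (u : 'rV[R]_n -> R)
    (y p : 'rV[R]_n) :
  (forall z, `|u z - u y - dot p (z - y)| <= K * dot (z - y) (z - y)) ->
  {for y, continuous u}.
Proof.
move=> h; have yy : (fun z : 'rV[R]_n => z) @ y --> y by exact: cvg_id.
have cy : (fun z : 'rV[R]_n => y) @ y --> y by exact: cvg_cst.
have e0 : (fun z => u z - u y - dot p (z - y)) @ y --> (0 : R).
  by apply: cvg0_le (cvg_dot0 K yy cy); apply: nearW.
have h2 : (fun z => (u z - u y - dot p (z - y)) + (u y + dot p (z - y))) @ y -->
    0 + (u y + dot p (y - y)).
  apply: cvgD => //; apply: cvgD; first exact: cvg_cst.
  by apply: cvg_dot; [exact: cvg_cst|exact: cvg_subr].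
rewrite subrr dot0r addr0 add0r in h2.
rewrite /continuous_at; apply: cvg_trans h2; apply: near_eq_cvg.
by apply: nearW => z; ring.
Qed.

(** * Limits of functions with quadratic contact along an ultrafilter *)

Section JetsLimit.
Context {R : realType} {n : nat} (A : bool -> 'M[R]_n -> Prop) (K : R).
Context (F : set_system nat) {UF : UltraFilter F}.
Implicit Types (x y z : 'rV[R]_n).

Variables (D Gam : nat -> set 'rV[R]_n) (U : nat -> bool -> 'rV[R]_n -> R).
Variables (G : nat -> bool -> 'rV[R]_n -> 'rV[R]_n) (Y : 'rV[R]_n -> nat -> 'rV[R]_n).
Hypothesis K0 : 0 <= K.
Hypothesis Acl : forall i, symmx_closed (A i).
Hypothesis J : forall k, jets A K (D k) (Gam k) (U k) (G k).
Hypothesis Gam0 : forall k, Gam k 0.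
Hypothesis U0 : forall k i, U k i 0 = 0.
Hypothesis G0 : forall k i, G k i 0 = 0.
Hypothesis Dlarge : forall rho : R, \forall k \near F, forall z, `|z| <= rho -> D k z.
Hypothesis YF : forall y, Y y @ F --> y.
Hypothesis GamY : forall y, \forall k \near F, Gam k (Y y k).

#[local] Instance UFF : Filter F.
Proof. exact: @filter_filter _ _ (@ultra_proper _ _ UF). Qed.

Let limU i y : R := lim ((fun k => U k i y) @ F).
Let limG i y : 'rV[R]_n := lim ((fun k => G k i (Y y k)) @ F).

Let GY_le i y (e : R) : 0 < e ->
  \forall k \near F, `|Y y k| <= e -> `|G k i (Y y k)| <= 3 * K * n.+1%:R * `|Y y k|.
Proof.
move=> e0; apply: (filterS2 _ _ (Dlarge e) (GamY y)) => k hD hG Ye.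
have D0 : D k 0 by apply: hD; rewrite normr0 ltW.
have := @jets_lipschitz _ _ _ _ _ _ _ _ i _ _ `|Y y k| K0 (J k) hG (Gam0 k) D0.
rewrite G0 !subr0; apply => // z; rewrite subr0 => zY; apply: hD.
exact: le_trans Ye.
Qed.

Let limGP i y : (fun k => G k i (Y y k)) @ F --> limG i y.
Proof.
apply: (@ultra_cvg_rV _ _ _ _ _ _ (3 * K * n.+1%:R * (`|y| + 1))).
have e0 : 0 < `|y| + 1 by rewrite ltr_wpDl.
apply: (filterS2 _ _ (GY_le i y e0) (cvg_near_ball ltr01 (@YF y))) => k h Yk.
have Ye : `|Y y k| <= `|y| + 1.
  rewrite -[Y y k](subrK y) (le_trans (ler_normD _ _))// addrC lerD2l.
  exact: ltW.
apply: le_trans (h Ye) _; rewrite ler_wpM2l// !mulr_ge0//.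
Qed.

Let limUP i y : (fun k => U k i y) @ F --> limU i y.
Proof.
apply: (@ultra_cvg _ _ _ _ _ (K * dot y y)).
apply: filterS (Dlarge `|y|) => k /(_ y (lexx _)) Dy.
by have := jets_c11 (J k) i (Gam0 k) Dy; rewrite U0 G0 dot0l !subr0.
Qed.

Let limG0 i : limG i 0 = 0.
Proof.
have h : (fun k => `|G k i (Y 0 k)|) @ F --> `|limG i 0|.
  by apply: cvg_norm; exact: limGP.
have k : (fun k => 3 * K * n.+1%:R * `|Y 0 k|) @ F --> 3 * K * n.+1%:R * `|0 : 'rV[R]_n|.
  by apply: cvgMr; exact: (cvg_norm (@YF 0)).
apply/eqP; rewrite -normr_le0.
have := ler_cvg_to h k; rewrite normr0 mulr0; apply.
apply: (filterS2 _ _ (GY_le i 0 ltr01) (cvg_near_ball ltr01 (@YF 0))) => m.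
by rewrite subr0 => hm /ltW /hm.
Qed.

Let c11_seq i y (X : nat -> 'rV[R]_n) x : X @ F --> x ->
  \forall k \near F, `|U k i (X k) - U k i (Y y k) - dot (G k i (Y y k)) (X k - Y y k)|
     <= K * dot (X k - Y y k) (X k - Y y k).
Proof.
move=> Xx.
apply: (filterS3 _ _ (GamY y) (Dlarge (`|x| + 1)) (cvg_near_ball ltr01 Xx)) => k hG hD Xk.
apply: (jets_c11 (J k)) => //; apply: hD.
rewrite -[X k](subrK x) (le_trans (ler_normD _ _))// addrC lerD2l.
exact: ltW.
Qed.

(** The expansion at the contact points [Y x k] replaces equicontinuity: it controls [U k i] both at
    [X k] and at [x]. *)
Let limU_seq i (X : nat -> 'rV[R]_n) x : X @ F --> x ->
  (fun k => U k i (X k)) @ F --> limU i x.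
Proof.
move=> Xx.
have cx : (fun _ : nat => x) @ F --> x by exact: cvg_cst.
pose e (X : nat -> 'rV[R]_n) k :=
  U k i (X k) - U k i (Y x k) - dot (G k i (Y x k)) (X k - Y x k).
have eP X' : X' @ F --> x -> e X' @ F --> (0 : R).
  by move=> h; apply: cvg0_le (c11_seq i x h) (cvg_dot0 K h (@YF x)).
have dG X' : X' @ F --> x -> (fun k => dot (G k i (Y x k)) (X' k - Y x k)) @ F --> (0 : R).
  move=> h; rewrite -(dot0r (limG i x)) -(subrr x).
  by apply: cvg_dot => //; exact: cvg_subr.
have h : (fun k => e X k - e (fun=> x) k + dot (G k i (Y x k)) (X k - Y x k) -
    dot (G k i (Y x k)) (x - Y x k) + U k i x) @ F --> 0 - 0 + 0 - 0 + limU i x.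
  apply: cvgD => //; apply: cvgB; last exact: dG.
  by apply: cvgD; [apply: cvgB; exact: eP|exact: dG].
rewrite subr0 addr0 subr0 add0r in h.
apply: cvg_trans h; apply: near_eq_cvg.
by apply: nearW => k; rewrite /e; ring.
Qed.

Let limU_c11 i y z :
  `|limU i z - limU i y - dot (limG i y) (z - y)| <= K * dot (z - y) (z - y).
Proof.
have cz : (fun _ : nat => z) @ F --> z by exact: cvg_cst.
have := c11_seq i y cz; apply: ler_cvg_to.
  apply: cvg_norm; apply: cvgB.
    by apply: cvgB => //; exact: limU_seq.
  by apply: cvg_dot => //; exact: cvg_subr.
by apply: cvgMr; apply: cvg_dot; exact: cvg_subr.
Qed.

(** Stability of viscosity subsolutions: adding [eps] to the Hessian makes the contact at [x]
    strict, so maximum points [X k] of [U k i - P] tend to [x], and there [U k i] is touched with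
    the same Hessian. Closedness of [A i] removes [eps]. *)
Let limU_subsol i : subsol (A i) setT (limU i).
Proof.
move=> x p S r _ r0 sS H; apply: Acl => // eps eps0.
pose rho := r / 2; have rho0 : 0 < rho by rewrite divr_gt0.
pose P y := limU i x + dot p (y - x) + 2^-1 * qf (S + eps%:M) (y - x).
have qfE v : qf (S + eps%:M) v = qf S v + eps * dot v v.
  by rewrite qfDl -scalemx1 qfZl qf1.
have sSe : (S + eps%:M)^T = S + eps%:M by rewrite linearD /= sS tr_scalar_mx.
(* The witness [x] is a default for indices at which the ball is not yet contained in [D k]. *)
have hX k : exists w, (forall z, `|z| <= `|x| + rho -> D k z) -> `|w - x| <= rho /\
    forall y, `|y - x| <= rho -> U k i y - P y <= U k i w - P w.
  have [hD|hD] := pselect (forall z, `|z| <= `|x| + rho -> D k z); last by exists x.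
  have [||w hw] := @box_max _ _ x rho (fun y => U k i y - P y); last by exists w.
    exact: ltW.
  move=> y yx; apply: cvgB; last exact: quad_continuous.
  apply: (jets_continuous (J k)); apply: hD.
  by rewrite -[y](subrK x) (le_trans (ler_normD _ _))// addrC lerD2l.
have [X HX] := choice hX.
have nearX : \forall k \near F, `|X k - x| <= rho /\
    forall y, `|y - x| <= rho -> U k i y - P y <= U k i (X k) - P (X k).
  by apply: filterS (Dlarge (`|x| + rho)) => k /HX.
have : X @ F --> lim (X @ F).
  apply: (@ultra_cvg_rV _ _ _ _ _ _ (`|x| + rho)).
  apply: filterS nearX => k [h _].
  by rewrite -[X k](subrK x) (le_trans (ler_normD _ _))// addrC lerD2l.
move: (lim (X @ F)) => xs Xxs.
have xsx : `|xs - x| <= rho.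
  have c1 : (fun k => `|X k - x|) @ F --> `|xs - x|.
    by apply: cvg_norm; apply: cvg_subr => //; exact: cvg_cst.
  apply: (ler_cvg_to c1 (cvg_cst rho)).
  by apply: filterS nearX => k [].
have cP (Z : nat -> 'rV[R]_n) z : Z @ F --> z -> (fun k => P (Z k)) @ F --> P z.
  move=> Zz; have h : (fun k => Z k - x) @ F --> z - x.
    by apply: cvg_subr => //; exact: cvg_cst.
  apply: cvgD; last by apply: cvgMr; exact: cvg_qf.
  by apply: cvgD; [exact: cvg_cst|apply: cvg_dot => //; exact: cvg_cst].
have cx : (fun _ : nat => x) @ F --> x by exact: cvg_cst.
have xsE : limU i x - P x <= limU i xs - P xs.
  have c1 : (fun k => U k i x - P x) @ F --> limU i x - P x.
    by apply: cvgB => //; exact: cP.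
  have c2 : (fun k => U k i (X k) - P (X k)) @ F --> limU i xs - P xs.
    by apply: cvgB; [exact: limU_seq|exact: cP].
  apply: (ler_cvg_to c1 c2).
  apply: filterS nearX => k [_ h]; apply: h.
  by rewrite subrr normr0 ltW.
(* The limit also maximizes [limU i - P] up to the value at [x], and strictness leaves only [x]. *)
have xsx0 : xs = x.
  have := H xs; rewrite (le_lt_trans xsx); last by rewrite /rho; lra.
  move=> /(_ isT) Hxs.
  move: xsE; rewrite /P subrr dot0r qf0 qfE => xsE.
  have : eps * dot (xs - x) (xs - x) <= 0 by lra.
  rewrite pmulr_rle0// => hle; apply/eqP; rewrite -subr_eq0; apply/eqP.
  by apply: dot_eq0; apply/eqP; rewrite eq_le hle dot_ge0.
rewrite xsx0 in Xxs.
have rho20 : 0 < rho / 2 by rewrite divr_gt0.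
have FE : F (fun k => (`|X k - x| <= rho /\
    forall y, `|y - x| <= rho -> U k i y - P y <= U k i (X k) - P (X k)) /\
    `|X k - x| < rho / 2 /\ forall z, `|z| <= `|x| + rho -> D k z).
  by apply: (filterS3 _ _ nearX (cvg_near_ball rho20 Xxs) (Dlarge (`|x| + rho))).
have [k [[Xk hk] [Xkx hD]]] := filter_ex FE.
have HS : subsol (A i) (D k) (U k i) by exact: (jets_subsol (J k)).
have DX : D k (X k).
  apply: hD; rewrite -[X k](subrK x) (le_trans (ler_normD _ _))// addrC.
  by rewrite lerD2l.
(* Recentring [P] at [X k] changes its slope by [(X k - x) *m (S + eps%:M)] and keeps its
   Hessian. *)
apply: (HS (X k) (p + (X k - x) *m (S + eps%:M)) _ (rho / 2) DX rho20 sSe).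
move=> y yX.
have yx : `|y - x| <= rho.
  rewrite -[y](subrK (X k)) -addrA (le_trans (ler_normD _ _))//.
  by move: yX Xkx; lra.
have := hk y yx.
have -> : P y = P (X k) + dot (p + (X k - x) *m (S + eps%:M)) (y - X k) +
    2^-1 * qf (S + eps%:M) (y - X k).
  have -> : P y = limU i x + dot p (y - x) + 2^-1 * qf (S + eps%:M) ((X k - x) + (y - X k)).
    by rewrite /P addrC [X k - x + _]addrC subrKA [in RHS]addrC.
  by rewrite (qfDr (X k - x) (y - X k) sSe) /P !dotL; field.
by lra.
Qed.

(** Every [y] is a limit of contact points [Y y k], so the expansions pass to the limit and every
    point becomes a contact point. The gradients at 0 stay 0 by the Lipschitz bound between contact
    points. *)
Lemma jets_lim : exists U' G', [/\ jets A K setT setT U' G',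
  (forall i, U' i 0 = 0), (forall i, G' i 0 = 0) &
  forall i y, (fun k => G k i (Y y k)) @ F --> (G' i y : 'rV[R]_n)].
Proof.
exists limU, limG; split => //.
- split => //.
  + move=> y z _ _.
    have cz : (fun _ : nat => z) @ F --> z by exact: cvg_cst.
    have cGY : (fun k => G k true (Y y k) + G k false (Y y k)) @ F -->
      limG true y + limG false y by apply: cvgD.
    have c1 : (fun k => U k true z + U k false z) @ F --> limU true z + limU false z.
      by apply: cvgD.
    have c2 : (fun k => U k true (Y y k) + U k false (Y y k) +
      dot (G k true (Y y k) + G k false (Y y k)) (z - Y y k)) @ F -->
      limU true y + limU false y + dot (limG true y + limG false y) (z - y).
      apply: cvgD; first by apply: cvgD; exact: limU_seq.
      by apply: cvg_dot => //; exact: cvg_subr.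
    apply: (ler_cvg_to c1 c2).
    apply: (filterS2 _ _ (Dlarge `|z|) (GamY y)) => k hD hG.
    by apply: (jets_concave (J k)) => //; exact: hD.
  + by move=> i z _; apply: (@c11_continuous _ _ K _ _ (limG i z)) => w.
- move=> i; apply/esym; rewrite /limU.
  under eq_fun do rewrite U0.
  by rewrite lim_cst.
Qed.

End JetsLimit.

(** * Entire limits are quadratic *)

Section Extremal.
Context {R : realType} {n : nat} (A : bool -> 'M[R]_n -> Prop) (K : R).
Hypothesis K0 : 0 <= K.
Hypothesis Acl : forall i, symmx_closed (A i).
Implicit Types (x y z : 'rV[R]_n) (U : bool -> 'rV[R]_n -> R).
Implicit Types (G : bool -> 'rV[R]_n -> 'rV[R]_n) (c : bool * 'I_n).

Definition entire U G := [/\ jets A K setT setT U G,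
  (forall i, U i 0 = 0) & (forall i, G i 0 = 0)].

Definition comp c G x : R := G c.1 x 0 c.2.

Definition lin (g : 'rV[R]_n -> R) :=
  (forall x y, g (x + y) = g x + g y) /\ (forall t x, g (t *: x) = t * g x).

Definition linear_on (s : seq (bool * 'I_n)) G := forall c, c \in s -> lin (comp c G).

(** A component that is already linear is unchanged by rescaling, so each new zoom keeps what the
    earlier ones achieved. *)
Lemma entire_rescale s U G (m : 'rV[R]_n) (h : R) : 0 < h ->
  entire U G -> linear_on s G ->
  entire (rsU m h U G) (rsG m h G) /\ linear_on s (rsG m h G).
Proof.
move=> h0 [J U0 G0] L; split.
  split; first by have := jets_rescale m h0 J.
    by move=> i; rewrite /rsU scaler0 addr0 dot0r mulr0 subr0 subrr mul0r.
  by move=> i; rewrite /rsG scaler0 addr0 subrr scaler0.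
move=> c /L [La Lm].
have E x : comp c (rsG m h G) x = comp c G x.
  rewrite /comp /rsG !mxE -!/(comp c G _) La Lm addrC addKr mulrA mulVf ?mul1r//.
  by rewrite gt_eqF.
by split=> [x y|t x]; rewrite !E ?La ?Lm.
Qed.

Let C : R := 3 * K * n.+1%:R.

Lemma entire_lipschitz U G i x y : entire U G -> `|G i x - G i y| <= C * `|x - y|.
Proof. by move=> [J _ _]; exact: jets_lipschitz J _ _ _ _ _. Qed.

Lemma comp_le_norm U G c y : entire U G -> `|comp c G y| <= C * `|y|.
Proof.
move=> e; have := entire_lipschitz c.1 y 0 e; have [_ _ ->] := e.
by rewrite !subr0; apply: le_trans; exact: le_coord_norm.
Qed.

(** Starting from [- T e] gives [g x <= l (|x + T e| - T)], and
    [|x + T e| <= T + x.e + |x|^2 / (2T)]; then [T] tends to infinity. The Lipschitz condition uses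
    any bound [a] of the distance, which avoids square roots. *)
Lemma lipschitz_line_le (g : 'rV[R]_n -> R) (l : R) (e : 'rV[R]_n) :
  0 <= l -> dot e e <= 1 ->
  (forall x y (a : R), 0 <= a -> dot (y - x) (y - x) <= a ^+ 2 -> g y - g x <= l * a) ->
  (forall T : R, 0 < T -> g (- T *: e) <= - (l * T)) ->
  forall x, g x <= l * dot x e.
Proof.
move=> l0 e1 gl gT x; apply/ler_addgt0Pr => eps eps0.
(* The summand [q] brings the error [l |x|^2 / (2T)] below [eps]; the other two keep [T + x.e]
   positive. *)
pose q := l * dot x x / eps; pose T := 1 + `|dot x e| + q.
have q0 : 0 <= q by rewrite divr_ge0 ?mulr_ge0 ?dot_ge0// ltW.
have xe : - `|dot x e| <= dot x e by rewrite lerNl -normrN ler_norm.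
have d0 : 0 <= `|dot x e| by [].
have T0 : 0 < T by rewrite /T; lra.
have xx0 : 0 <= dot x x / (2 * T) by rewrite divr_ge0 ?dot_ge0// mulr_ge0// ltW.
have hT : l * (dot x x / (2 * T)) <= eps.
  rewrite mulrA ler_pdivrMr ?mulr_gt0//.
  have -> : l * dot x x = eps * q by rewrite /q; field; rewrite gt_eqF.
  by rewrite ler_pM2l// /T; lra.
have a0 : 0 <= T + dot x e + dot x x / (2 * T) by rewrite /T in xx0 *; lra.
have := gl (- T *: e) x _ a0; rewrite scaleNr opprK.
have -> : (T + dot x e + dot x x / (2 * T)) ^+ 2 =
    T ^+ 2 + 2 * T * dot x e + dot x x + (dot x e + dot x x / (2 * T)) ^+ 2.
  by field; rewrite gt_eqF.
rewrite !dotL (dotC e x).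
have := sqr_ge0 (dot x e + dot x x / (2 * T)).
have : T * (T * dot e e) <= T ^+ 2 by rewrite mulrA -expr2 ler_piMr// sqr_ge0.
move=> h1 h2 /(_ ltac:(lra)); have := gT T T0; rewrite scaleNr.
by move: hT; lra.
Qed.

(* McShane: a function with Lipschitz constant [l] that grows at the maximal
   rate [l] along a whole line is linear. *)
Lemma lipschitz_line_linear (g : 'rV[R]_n -> R) (l : R) (e : 'rV[R]_n) :
  0 <= l -> dot e e <= 1 ->
  (forall x y (a : R), 0 <= a -> dot (y - x) (y - x) <= a ^+ 2 -> g y - g x <= l * a) ->
  (forall T : R, 0 < T -> l * T <= g (T *: e) /\ g (- T *: e) <= - (l * T)) ->
  forall x, g x = l * dot x e.
Proof.
move=> l0 e1 gl gT x; apply/eqP; rewrite eq_le; apply/andP; split.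
  by apply: lipschitz_line_le => // T /gT[].
have := @lipschitz_line_le (fun z => - g (- z)) l e l0 e1 _ _ (- x).
rewrite opprK dotNl mulrN lerNr opprK; apply.
  move=> y z a a0 yz; rewrite opprK addrC; apply: gl => //.
  by rewrite opprK addrC.
by move=> T /gT[h _]; rewrite scaleNr opprK lerN2.
Qed.

(* The largest slope is attained in the limit by segments of unit length;
   zooming in at their midpoints turns the segment into a line. *)
Lemma linear_on_cons s c :
  (exists U G, entire U G /\ linear_on s G) ->
  exists U G, entire U G /\ linear_on (c :: s) G.
Proof.
move=> [U1 [G1 [e1 L1]]].
pose cand (w : (bool -> 'rV[R]_n -> R) * (bool -> 'rV[R]_n -> 'rV[R]_n) * 'rV[R]_n) :=
  [/\ entire w.1.1 w.1.2, linear_on s w.1.2 & dot w.2 w.2 <= 1].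
(* The supremum runs over all candidates at once, because this class, unlike a single function, is
   invariant under recentring and rescaling. *)
pose E := [set t : R | exists2 w, cand w & t = comp c w.1.2 w.2].
have C0 : 0 <= C by rewrite /C !mulr_ge0.
have E0 : E 0.
  exists (U1, G1, 0); first by split => //=; rewrite dot0l.
  by rewrite /= /comp; have [_ _ ->] := e1; rewrite mxE.
have norm_le1 y : dot y y <= 1 -> `|y| <= 1.
  by move=> y1; rewrite -(@expr_le1 _ 2)// (le_trans (norm_sqr_le _))// .
have EC : ubound E C.
  move=> t [[[U G] y] [/= e L y1] ->]; rewrite (le_trans (ler_norm _))//.
  by rewrite (le_trans (comp_le_norm c y e))// ler_piMr// norm_le1.
have supE : has_sup E by split; [exists 0|exists C].
pose l := sup E.
have l0 : 0 <= l by exact: (sup_upper_bound supE E0).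
(* Recentring at [x] and rescaling by [a] turns a difference quotient into an element of [E]; hence
   [l] is a common Lipschitz constant. *)
have lip U G : entire U G -> linear_on s G -> forall x y (a : R), 0 <= a ->
    dot (y - x) (y - x) <= a ^+ 2 -> comp c G y - comp c G x <= l * a.
  move=> e L x y a a0 yxa; have [a00|an0] := eqVneq a 0.
    move: yxa; rewrite a00 expr0n mulr0 /= => yx.
    have : dot (y - x) (y - x) = 0 by apply/eqP; rewrite eq_le yx dot_ge0.
    by move=> /dot_eq0/eqP; rewrite subr_eq0 => /eqP ->; rewrite subrr.
  have agt0 : 0 < a by rewrite lt_def an0.
  have [e' L'] := entire_rescale x agt0 e L.
  have : E (comp c (rsG x a G) (a^-1 *: (y - x))).
    exists (rsU x a U G, rsG x a G, a^-1 *: (y - x)) => //; split => //=.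
    rewrite dotZl dotZr mulrA -expr2 exprVn ler_pdivrMl ?exprn_gt0//.
    by rewrite mulr1.
  move=> /(sup_upper_bound supE); rewrite -/l /comp /rsG !mxE.
  rewrite scalerA divff// scale1r [x + _]addrC subrK.
  by rewrite ler_pdivrMl// [a * l]mulrC.
(* The defect is the square of the zoom factor [h k], so that after magnification by its inverse it
   is [h k] and still vanishes. *)
have seqP (k : nat) : exists w, cand w /\ l - (k.+1%:R^-1) ^+ 2 < comp c w.1.2 w.2.
  have [|t [w cw ->] lt] := @sup_adherent _ E ((k.+1%:R^-1) ^+ 2) _ supE.
    by rewrite exprn_gt0// invr_gt0.
  by exists w.
have [w wP] := choice seqP.
pose h (k : nat) : R := k.+1%:R^-1.
have h0 k : 0 < h k by rewrite /h invr_gt0.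
pose m k := 2^-1 *: (w k).2.
pose U k := rsU (m k) (h k) (w k).1.1 (w k).1.2.
pose G k := rsG (m k) (h k) (w k).1.2.
have eL k : entire (U k) (G k) /\ linear_on s (G k).
  by have [[? ? ?] _] := wP k; exact: entire_rescale.
(* The whole segment gains almost [l] and no piece gains more than its share, so every piece gains
   almost its share. *)
have slope k (a b : R) : 0 <= a -> a <= b -> b <= 1 ->
    l * (b - a) - h k ^+ 2 <=
    comp c (w k).1.2 (b *: (w k).2) - comp c (w k).1.2 (a *: (w k).2).
  move=> a0 ab b1; have [[e L w1] lw] := wP k.
  have key (x y : R) : x <= y -> comp c (w k).1.2 (y *: (w k).2) -
      comp c (w k).1.2 (x *: (w k).2) <= l * (y - x).
    move=> xy; apply: (lip _ _ e L); first by rewrite subr_ge0.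
    by rewrite -scalerBl dotZl dotZr mulrA -expr2 ler_piMr ?sqr_ge0.
  have h1 := key _ _ b1; have h2 := key _ _ a0.
  have c0 : comp c (w k).1.2 0 = 0 by have [_ _ G0] := e; rewrite /comp G0 mxE.
  move: h1 h2 lw; rewrite scale1r scale0r c0.
  have -> : l * (b - a) = l - l * (1 - b) - l * a by ring.
  by rewrite -/(h k) !subr0; lra.
(* In the zoom at the midpoint the near-maximal gain holds on a segment of parameters of half-length
   [(2 h k)^-1]. *)
have slopeG k (a b : R) : a <= b -> `|a| * h k <= 2^-1 -> `|b| * h k <= 2^-1 ->
    l * (b - a) - h k <= comp c (G k) (b *: (w k).2) - comp c (G k) (a *: (w k).2).
  move=> ab ha hb; have hk := h0 k.
  have E1 t : m k + h k *: (t *: (w k).2) = (2^-1 + h k * t) *: (w k).2.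
    by rewrite scalerDl scalerA.
  have -> : comp c (G k) (b *: (w k).2) - comp c (G k) (a *: (w k).2) =
    (h k)^-1 * (comp c (w k).1.2 ((2^-1 + h k * b) *: (w k).2) -
              comp c (w k).1.2 ((2^-1 + h k * a) *: (w k).2)).
    by rewrite /comp /G /rsG !E1 !mxE; ring.
  rewrite ler_pdivlMl//.
  have bnd (t : R) : `|t| * h k <= 2^-1 -> - 2^-1 <= h k * t <= 2^-1.
    by rewrite -ler_norml normrM (gtr0_norm hk) mulrC.
  have /andP[? ?] := bnd _ ha; have /andP[? ?] := bnd _ hb.
  have hab : h k * a <= h k * b by rewrite ler_pM2l.
  have := slope k (2^-1 + h k * a) (2^-1 + h k * b).
  have -> : h k * (l * (b - a) - h k) =
    l * (2^-1 + h k * b - (2^-1 + h k * a)) - h k ^+ 2 by ring.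
  by apply; lra.
have [F [UF sF]] := @ultraFilterLemma nat \oo _.
have FF : Filter F by exact: @filter_filter _ _ (@ultra_proper _ _ UF).
have hF : h @ F --> (0 : R).
  by move=> B hB; apply: sF; exact: (@cvg_harmonic R).
have [|||||||U' [G' [J' U'0 G'0 G'P]]] := @jets_lim _ _ A K F UF (fun=> setT)
  (fun=> setT) U G (fun y _ => y) K0 Acl; try by [].
- by move=> k; have [[]] := eL k.
- by move=> k i; have [[_ ->]] := eL k.
- by move=> k i; have [[_ _ ->]] := eL k.
- by move=> rho; exact: nearW.
- by move=> y; exact: cvg_cst.
- by move=> y; exact: nearW.
have cG c' x : (fun k => comp c' (G k) x) @ F --> comp c' G' x.
  rewrite /comp; apply: (@cvg_coord _ _ _ F (fun k => G k c'.1 x)); exact: G'P.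
have eU' : entire U' G' by split.
have L' : linear_on s G'.
  move=> c' c's; split=> [x y|t x].
    have h1 : (fun k => comp c' (G k) x + comp c' (G k) y) @ F -->
      comp c' G' x + comp c' G' y by apply: cvgD; exact: cG.
    have h2 := cG c' (x + y).
    have E1 : (fun k => comp c' (G k) (x + y)) = (fun k => comp c' (G k) x + comp c' (G k) y).
      by apply/funext => k; have [_ /(_ _ c's)[-> _]] := eL k.
    rewrite E1 in h2; exact: (cvg_unique _ h2 h1).
  have h1 : (fun k => t * comp c' (G k) x) @ F --> t * comp c' G' x.
    by apply: cvgMr; exact: cG.
  have h2 := cG c' (t *: x).
  have E1 : (fun k => comp c' (G k) (t *: x)) = (fun k => t * comp c' (G k) x).
    by apply/funext => k; have [_ /(_ _ c's)[_ ->]] := eL k.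
  rewrite E1 in h2; exact: (cvg_unique _ h2 h1).
exists U', G'; split => // c'; rewrite inE => /orP[/eqP ->|/L'//].
have we : (fun k => (w k).2) @ F --> lim ((fun k => (w k).2) @ F).
  apply: (@ultra_cvg_rV _ _ _ _ _ _ 1); apply: nearW => k.
  by have [[_ _ /norm_le1]] := wP k.
move: (lim _) we => e we.
have ee : dot e e <= 1.
  have c1 : (fun k => dot (w k).2 (w k).2) @ F --> dot e e by exact: cvg_dot.
  apply: (ler_cvg_to c1 (cvg_cst (1 : R))); apply: nearW => k.
  by have [[]] := wP k.
(* The directions [(w k).2] vary with [k]; the common Lipschitz bound replaces them by their limit
   [e]. *)
have cGw (t : R) : (fun k => comp c (G k) (t *: (w k).2)) @ F --> comp c G' (t *: e).
  have h1 : (fun k => comp c (G k) (t *: (w k).2) - comp c (G k) (t *: e)) @ F --> (0 : R).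
    apply: (@cvg0_le _ _ _ _ _ (fun k => C * `|t *: (w k).2 - t *: e|)).
      apply: nearW => k; have [ek _] := eL k.
      apply: le_trans (entire_lipschitz c.1 _ _ ek).
      by have := le_coord_norm (G k c.1 (t *: (w k).2) - G k c.1 (t *: e)) c.2; rewrite /comp !mxE; apply: le_trans.
    have h2 : (fun k => C * `|t *: (w k).2 - t *: e|) @ F --> C * `|t *: e - t *: e|.
      apply: cvgMr; apply: cvg_norm; apply: cvg_subr; last exact: cvg_cst.
      exact: cvgZr.
    by rewrite subrr normr0 mulr0 in h2.
  have h2 : (fun k => (comp c (G k) (t *: (w k).2) - comp c (G k) (t *: e)) +
     comp c (G k) (t *: e)) @ F --> 0 + comp c G' (t *: e) by apply: cvgD => //; exact: cG.
  rewrite add0r in h2; apply: cvg_trans h2; apply: near_eq_cvg.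
  by apply: nearW => k; ring.
have gE : forall x, comp c G' x = l * dot x e.
  apply: lipschitz_line_linear => //; first exact: (lip _ _ eU' L').
  have g0 : comp c G' 0 = 0 by rewrite /comp G'0 mxE.
  have small (T : R) : 0 < T -> \forall k \near F, T * h k <= 2^-1.
    move=> T0; have h1 : (fun k => T * h k) @ F --> T * 0 by exact: cvgMr.
    rewrite mulr0 in h1.
    have /cvgrPdist_lt/(_ _ (_ : 0 < 2^-1 :> R)) := h1; move=> /(_ ltac:(by [])).
    apply: filterS => k; rewrite sub0r normrN => /ltW.
    exact: le_trans (ler_norm _).
  have clh (T : R) : (fun k => l * T - h k) @ F --> l * T - 0.
    by apply: cvgB => //; exact: cvg_cst.
  have G0 k : comp c (G k) (0 *: (w k).2) = 0.
    by rewrite scale0r; have [[_ _ G00] _] := eL k; rewrite /comp G00 mxE.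
  move=> T T0; split.
    have := ler_cvg_to (clh T) (cGw T); rewrite subr0; apply.
    apply: filterS (small T T0) => k hk.
    have := slopeG k 0 T; rewrite normr0 mul0r G0 !subr0; apply => //.
    + exact: ltW.
    + by rewrite gtr0_norm.
  rewrite lerNr; have := ler_cvg_to (clh T) (cvgN (cGw (- T))); rewrite subr0; apply.
  apply: filterS (small T T0) => k hk.
  have := slopeG k (- T) 0; rewrite normr0 mul0r G0 !sub0r opprK; apply => //.
  + by rewrite oppr_le0 ltW.
  + by rewrite normrN gtr0_norm.
by split=> [x y|t x]; rewrite !gE !dotL; ring.
Qed.

End Extremal.

Section EntireQuadratic.
Context {R : realType} {n : nat} (A : bool -> 'M[R]_n -> Prop) (K : R).
Hypothesis K0 : 0 <= K.
Hypothesis Acl : forall i, symmx_closed (A i).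
Implicit Types (x y z : 'rV[R]_n).

(** Along the ray through [y] the difference [psi] from the expected quadratic changes by at most
    [c s^2] over a step [s]; [k] steps of length [1/k] give [|psi 1| <= c/k]. *)
Lemma quadratic_of_linear_gradient (u : 'rV[R]_n -> R) (g : 'rV[R]_n -> 'rV[R]_n) :
  u 0 = 0 ->
  (forall y z, `|u z - u y - dot (g y) (z - y)| <= K * dot (z - y) (z - y)) ->
  (forall t y, g (t *: y) = t *: g y) ->
  forall y, u y = 2^-1 * dot (g y) y.
Proof.
move=> u0 hu gZ y; pose b := dot (g y) y; pose c := K * dot y y + `|b|.
pose psi (t : R) := u (t *: y) - t ^+ 2 * (2^-1 * b).
have c0 : 0 <= c by rewrite addr_ge0// mulr_ge0// dot_ge0.
have step t s : `|psi (t + s) - psi t| <= c * s ^+ 2.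
  have := hu (t *: y) ((t + s) *: y).
  rewrite -scalerBl [t + s - t]addrAC subrr add0r gZ !dotL -/b => H.
  have -> : psi (t + s) - psi t =
    u ((t + s) *: y) - u (t *: y) - t * (s * b) - 2^-1 * b * s ^+ 2.
    by rewrite /psi; field.
  apply: le_trans (ler_normB _ _) _.
  rewrite /c mulrDl; apply: lerD; first by apply: le_trans H _; rewrite le_eqVlt; apply/orP; left; apply/eqP; ring.
  rewrite normrM (ger0_norm (sqr_ge0 s)) ler_wpM2r ?sqr_ge0//.
  by rewrite normrM gtr0_norm ?invr_gt0// ler_piMl// invf_le1// ler1n.
have psi0 : psi 0 = 0 by rewrite /psi scale0r u0; ring.
have iter_step (s : R) (k : nat) : `|psi (k%:R * s)| <= k%:R * (c * s ^+ 2).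
  elim: k => [|k IH]; first by rewrite !mul0r psi0 normr0.
  rewrite -natr1 mulrDl mul1r -[psi _](subrK (psi (k%:R * s))).
  apply: le_trans (ler_normD _ _) _; rewrite mulrDl mul1r addrC.
  by apply: lerD => //; exact: step.
suff : psi 1 = 0.
  by rewrite /psi scale1r expr1n mul1r => /eqP; rewrite subr_eq0 => /eqP.
apply/eqP; rewrite -normr_le0; apply/ler_addgt0Pr => eps eps0; rewrite add0r.
have [k hk] : exists k : nat, c / eps < k.+1%:R.
  exists (Num.truncn (c / eps)); exact: truncnS_gt.
have k0 : 0 < k.+1%:R :> R by rewrite ltr0n.
have := iter_step (k.+1%:R^-1) k.+1.
rewrite divff ?gt_eqF// => h; apply: le_trans h _.
have -> : k.+1%:R * (c * k.+1%:R^-1 ^+ 2) = c / k.+1%:R by field; rewrite addrC natr1 gt_eqF.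
rewrite ler_pdivrMr// mulrC -ler_pdivrMr//; exact: ltW.
Qed.

(** Once all components of both gradients are linear, the functions are quadratic; each touches
    itself, which puts its Hessian in [A i], and concavity at 0 gives the sign of the sum. *)
Lemma entire_sum_le0 U G : entire A K U G -> exists S : bool -> 'M[R]_n,
  [/\ (forall i, (S i)^T = S i), (forall i, A i (S i)) &
   forall y, qf (S true) y + qf (S false) y <= 0].
Proof.
move=> e.
have [{e U G}U [G [[J U0 G0] L]]] : exists U G, entire A K U G /\
    linear_on (enum {: bool * 'I_n}) G.
  elim: (enum _) => [|c s IH]; first by exists U, G.
  exact: linear_on_cons.
have Lc c : lin (comp c G) by apply: L; rewrite mem_enum.
pose B i : 'M[R]_n := \matrix_(j, l) G i (delta_mx 0 j) 0 l.
have GB i y : G i y = y *m B i.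
  apply/rowP => l; rewrite mxE.
  have [La Lm] := Lc (i, l).
  have L0 : comp (i, l) G 0 = 0 by rewrite -(scale0r (0 : 'rV[R]_n)) Lm mul0r.
  rewrite -/(comp (i, l) G y) {1}(row_sum_delta y).
  rewrite (big_morph (comp (i, l) G) La L0); apply: eq_bigr => j _.
  by rewrite Lm mxE.
(* Only the symmetric part of [B i] enters the quadratic form. *)
pose S i := 2^-1 *: (B i + (B i)^T).
have qS i y : qf (S i) y = dot (G i y) y.
  rewrite /S qfZl qfDl; have -> : qf (B i)^T y = qf (B i) y.
    transitivity ((y *m B i *m y^T)^T 0 0); last by rewrite mxE.
    by rewrite !trmx_mul trmxK mulmxA.
  by rewrite /qf -GB -/(dot _ _); field.
have US i y : U i y = 2^-1 * qf (S i) y.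
  rewrite qS; apply: quadratic_of_linear_gradient => // [z w|t z].
    exact: (jets_c11 J).
  by rewrite !GB scalemxAl.
have sS i : (S i)^T = S i.
  by rewrite /S linearZ /= linearD /= trmxK addrC.
exists S; split => // [i|y].
  have HS : subsol (A i) setT (U i) by exact: (jets_subsol J).
  apply: (HS 0 0 (S i) 1 _ ltr01 (sS i)) => // y _.
  by rewrite subr0 U0 dot0l !add0r US.
have := @jets_concave _ _ _ _ _ _ _ _ J 0 y I I.
by rewrite !U0 !G0 !addr0 dot0l !US; lra.
Qed.

End EntireQuadratic.

(** * Counting in m-adic cubes *)

Section Cubes.
Context {R : realType} {n : nat}.
Implicit Types (a x y : 'rV[R]_n) (s : R).

(** Half-open, so that truncating the rescaled coordinates of a point finds a subcube containing
    it. *)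
Definition cube a s : set 'rV[R]_n :=
  [set x | forall i, a 0 i <= x 0 i < a 0 i + s].

Definition subcube_corner (m : nat) a s (c : {ffun 'I_n -> 'I_m}) : 'rV[R]_n :=
  \row_i (a 0 i + (c i)%:R * (s / m%:R)).

Lemma cube_dist a s x y : 0 < s -> cube a s x -> cube a s y -> `|x - y| < s.
Proof.
move=> s0 ax ay; apply: norm_coord_lt => // i; rewrite !mxE ltr_norml.
by have /andP[? ?] := ax i; have /andP[? ?] := ay i; apply/andP; split; lra.
Qed.

Lemma subcube_exists (m : nat) a s x : (0 < m)%N -> 0 < s -> cube a s x ->
  exists c : {ffun 'I_n -> 'I_m}, cube (subcube_corner a s c) (s / m%:R) x.
Proof.
move=> m0 s0 ax.
have h0 : 0 < s / m%:R by rewrite divr_gt0// ltr0n.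
pose q i := (x 0 i - a 0 i) / (s / m%:R).
have q0 i : 0 <= q i.
  by rewrite divr_ge0 ?(ltW h0)// subr_ge0; have /andP[] := ax i.
have qm i : (Num.truncn (q i) < m)%N.
  rewrite truncn_lt_nat// /q ltr_pdivrMr//.
  rewrite mulrC divfK ?pnatr_eq0 -?lt0n//.
  by have /andP[? ?] := ax i; lra.
exists [ffun i => Ordinal (qm i)] => i; rewrite !mxE ffunE /=.
have /andP[h1 h2] := truncn_itv (q0 i).
move: h1 h2; move: (Num.truncn (q i)) => t; rewrite /q ler_pdivlMr// ltr_pdivrMr// -natr1 mulrDl mul1r.
by move=> h1 h2; apply/andP; split; lra.
Qed.

(* If every cube met along the way has a subcube without points of [P], then
   [k] subdivisions leave at most [(m^n - 1)^k] nonempty cells, and two points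
   share a cell. *)
Lemma dense_cube (I : finType) (pos : I -> 'rV[R]_n) (m k : nat) a s (P : {set I}) :
  (0 < m)%N -> 0 < s -> (forall i, i \in P -> cube a s (pos i)) ->
  ((m ^ n).-1 ^ k < #|P|)%N ->
  (exists a' s', [/\ 0 < s', s' <= s, cube a' s' `<=` cube a s &
     forall c : {ffun 'I_n -> 'I_m}, exists2 i, i \in P &
       cube (subcube_corner a' s' c) (s' / m%:R) (pos i)]) \/
  (exists i j, [/\ i \in P, j \in P, i != j & `|pos i - pos j| < s / (m ^ k)%:R]).
Proof.
move=> m0; elim: k a s P => [|k IH] a s P s0 aP cP.
  right; move: cP; rewrite expn0 => /card_gt1P[i [j [iP jP ij]]].
  exists i, j; split => //; rewrite expn0 divr1.
  by apply: (cube_dist s0); exact: aP.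
have [full|] := pselect (forall c : {ffun 'I_n -> 'I_m}, exists2 i, i \in P &
       cube (subcube_corner a s c) (s / m%:R) (pos i)).
  by left; exists a, s; split.
move=> /existsNP[c0 hc0].
have [col hcol] : exists col : I -> {ffun 'I_n -> 'I_m}, forall i, i \in P ->
    cube (subcube_corner a s (col i)) (s / m%:R) (pos i).
  have h i : exists c : {ffun 'I_n -> 'I_m}, i \in P ->
      cube (subcube_corner a s c) (s / m%:R) (pos i).
    have [iP|iP] := boolP (i \in P); last by exists c0.
    by have [c hc] := subcube_exists m0 s0 (aP i iP); exists c.
  by have [f hf] := choice h; exists f.
pose Q c := [set i in P | col i == c].
(* Pigeonhole: the class of [c0] is empty, so if the other [m^n - 1] classes were all small, [P]
   would have at most [(m^n - 1)^(k+1)] elements. *)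
have [c hc] : exists c, ((m ^ n).-1 ^ k < #|Q c|)%N.
  apply: contrapT => /forallNP h.
  move: cP; apply/negP; rewrite -leqNgt -sum1_card (partition_big col predT)//=.
  rewrite (bigD1 c0)//= big_pred0 ?add0n; last first.
    move=> i; apply/negP => /andP[iP /eqP ci]; apply: hc0.
    by exists i => //; rewrite -ci; exact: hcol.
  apply: (@leq_trans (\sum_(c : {ffun 'I_n -> 'I_m} | c != c0) (m ^ n).-1 ^ k)%N).
    apply: leq_sum => c _; rewrite sum1_card.
    have := h c; move/negP; rewrite -leqNgt; apply: leq_trans.
    by apply: eq_leq; apply: eq_card => i; rewrite !inE.
  rewrite sum_nat_const expnS leq_mul2r; apply/orP; right.
  have := cardC1 c0; rewrite card_ffun !card_ord => <-.
  by apply: eq_leq; apply: eq_card => i; rewrite !inE.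
have sm0 : 0 < s / m%:R by rewrite divr_gt0// ltr0n.
have sms : s / m%:R <= s by rewrite ler_pdivrMr ?ltr0n// ler_peMr ?ler1n// ltW.
have QP i : i \in Q c -> i \in P by rewrite inE => /andP[].
have sub : cube (subcube_corner a s c) (s / m%:R) `<=` cube a s.
  move=> x hx i; have := hx i; rewrite !mxE => /andP[h1 h2].
  have c1 : 0 <= (c i)%:R * (s / m%:R) by rewrite mulr_ge0// ltW.
  have c2 : (c i)%:R * (s / m%:R) + s / m%:R <= s.
    rewrite -[X in _ + X <= _]mul1r -mulrDl natr1.
    rewrite -[leRHS](@divfK _ m%:R) ?pnatr_eq0 -?lt0n// mulrC ler_pM2l//.
    by rewrite ler_nat; exact: ltn_ord.
  by apply/andP; split; lra.
have [|[a' [s' [s'0 s's sub' h]]]|[i [j [iQ jQ ij hij]]]] := IH (subcube_corner a s c) _ (Q c) sm0 _ hc.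
- by move=> i; rewrite inE => /andP[iP /eqP <-]; exact: hcol.
- left; exists a', s'; split => //.
  + exact: le_trans sms.
  + exact: (subset_trans sub').
  + by move=> c'; have [i /QP iP hi] := h c'; exists i.
right; exists i, j; split; [exact: QP|exact: QP|by []|].
by rewrite expnS natrM invfM mulrA.
Qed.

(** With [M = N - 1], the first two terms of the binomial expansion of [(M + 1)^k] suffice:
    [k M^(k-1)] already exceeds [M^(k+t)] up to a positive remainder once [k = M^(t+1) + 1]. *)
Lemma expn_pred_lt (N t : nat) : (0 < N)%N ->
  exists k, (N.-1 ^ (k + t) < N ^ k)%N.
Proof.
case: N => // M _ /=; exists (M ^ t.+1).+1.
have h k : (M ^ k.+1 + k.+1 * M ^ k <= M.+1 ^ k.+1)%N.
  elim: k => [|k IH]; first by rewrite !expn1 expn0 muln1 addn1.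
  rewrite expnS [X in (_ <= X)%N]expnS.
  apply: leq_trans (leq_mul (leqnn M.+1) IH).
  rewrite [(M ^ k.+1)%N]expnS; nia.
apply: leq_trans (h _).
case: M h => [|M] h; first by rewrite (@exp0n t.+1)// add1n exp0n//.
rewrite -addn1 addnC; apply: leq_add; first by rewrite expn_gt0.
apply: (@leq_trans (M.+1 ^ t.+1 * M.+1 ^ (M.+1 ^ t.+1))%N); last first.
  by rewrite leq_mul2r leqnSn orbT.
by rewrite -expnD addSnnS addnC.
Qed.

(* [L^n] points at mutual distance of order [1/L] are too many for the at most
   [(m^n - 1)^k] cells of a Cantor-like set when [L = m^k'], [k = k' + T]. *)
Lemma dense_cube_of_expansion (Gam : set 'rV[R]_n) a s (T m : nat) :
  0 < s -> (0 < T)%N -> (1 < m)%N ->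
  (forall L, (0 < L)%N -> exists pos : {ffun 'I_n -> 'I_L} -> 'rV[R]_n,
    (forall i, Gam (pos i) /\ cube a s (pos i)) /\
    forall i j, i != j -> s / (T * L)%:R <= `|pos i - pos j|) ->
  exists a' s', [/\ 0 < s', s' <= s &
    forall c : {ffun 'I_n -> 'I_m}, exists2 x, Gam x &
      cube (subcube_corner a' s' c) (s' / m%:R) x].
Proof.
move=> s0 T0 m1 H.
have m0 : (0 < m)%N by apply: ltn_trans m1.
have mn0 : (0 < m ^ n)%N by rewrite expn_gt0 m0.
have [k hk] := expn_pred_lt T mn0.
have L0 : (0 < m ^ k)%N by rewrite expn_gt0 m0.
have [pos [hpos sep]] := H _ L0.
have [||[a' [s' [s'0 s's _ h]]]|[i [j [_ _ ij]]]] := @dense_cube _ pos m (k + T) a s [set: {ffun 'I_n -> 'I_(m ^ k)}]%SET m0 s0.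
- by move=> i _; have [] := hpos i.
- by rewrite cardsT card_ffun !card_ord -expnM mulnC expnM.
- exists a', s'; split => // c.
  by have [i _ hi] := h c; exists (pos i) => //; have [] := hpos i.
(* Sharing a cell forces a distance below [s / m^(k+T)], which is less than the separation because
   [T < m^T]. *)
move=> hij; exfalso; move: hij; apply/negP; rewrite -leNgt.
apply: le_trans (sep _ _ ij); rewrite ler_pM2l// lef_pV2 ?posrE ?ltr0n ?muln_gt0 ?T0 ?expn_gt0 ?m0//.
rewrite ler_nat addnC expnD leq_mul2r; apply/orP; right.
exact: ltnW (ltn_expl _ m1).
Qed.

End Cubes.

(** * Blow-up at contact points *)

Section Blowup.
Context {R : realType} {n : nat} (A : bool -> 'M[R]_n -> Prop) (K : R).
Hypothesis K0 : 0 <= K.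
Hypothesis Acl : forall i, symmx_closed (A i).
Implicit Types (x y z q : 'rV[R]_n) (Gam : set 'rV[R]_n).

(** Take [M = 2(k+1)], [m = M^2] and [x] in the subcube at the middle of the full cube. With
    [h = s'/M] the ball of radius [h (k+1)/2 = s'/4] about [x] stays in the cube, and the subcubes
    have side [h/M], fine compared with [h]. *)
Lemma dense_scale (Gam : set 'rV[R]_n) (s : R) (k : nat) : 0 < s ->
  (forall m, (1 < m)%N -> exists a' s', [/\ 0 < s', s' <= s &
    forall c : {ffun 'I_n -> 'I_m}, exists2 x, Gam x &
      cube (subcube_corner a' s' c) (s' / m%:R) x]) ->
  exists x (h : R), [/\ Gam x, 0 < h, h <= s / k.+1%:R &
    forall y, `|y| <= k.+1%:R / 2 -> exists y', Gam (x + h *: y') /\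
       `|y' - y| <= k.+1%:R^-1].
Proof.
move=> s0 H; pose M := (2 * k.+1)%N; pose m := (M * M)%N.
have M0 : 0 < M%:R :> R by rewrite ltr0n.
have M2 : 2 <= M%:R :> R by rewrite ler_nat /M; lia.
have ME : M%:R = 2 * k.+1%:R :> R by rewrite /M natrM.
have m1 : (1 < m)%N by rewrite /m /M; lia.
have mE : m%:R = M%:R * M%:R :> R by rewrite /m natrM.
have [a' [s' [s'0 s's full]]] := H m m1.
have cm : (2 * k.+1 * k.+1 < m)%N by rewrite /m /M; nia.
have [x Gx hx] := full [ffun => Ordinal cm].
pose h := s' / M%:R.
have h0 : 0 < h by rewrite divr_gt0.
have hM : s' / m%:R = h / M%:R by rewrite mE invfM mulrA.
exists x, h; split => //.
  rewrite /h ME ler_pdivrMr; last by rewrite mulr_gt0// ltr0n.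
  by rewrite mulrCA divfK ?pnatr_eq0//; lra.
move=> y yk.
have ax : cube a' s' (x + h *: y).
  move=> i; have := hx i; rewrite !mxE ffunE /= hM => /andP[h1 h2].
  have hyi : `|h * y 0 i| <= s' / 4.
    rewrite normrM gtr0_norm//.
    apply: (@le_trans _ _ (h * (k.+1%:R / 2))).
      by rewrite ler_pM2l// (le_trans (le_coord_norm _ _)).
    rewrite /h ME le_eqVlt; apply/orP; left; apply/eqP; field.
    by rewrite -natr1 in M0 *; rewrite addrC natr1 pnatr_eq0.
  have mid : (2 * k.+1 * k.+1)%:R * (h / M%:R) = s' / 2.
    rewrite /h ME !natrM; field.
    by rewrite addrC natr1 pnatr_eq0.
  rewrite mid in h1 h2.
  have hM4 : h / M%:R <= s' / 4.
    rewrite /h -mulrA -invfM ler_pM2l// lef_pV2 ?posrE ?mulr_gt0//.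
    by have := ler_pM _ _ M2 M2; lra.
  by move: hyi; rewrite ler_norml => /andP[? ?]; apply/andP; split; lra.
have [c hc] := subcube_exists (ltnW m1) s'0 ax.
have [x' Gx' hx'] := full c.
have hm0 : 0 < s' / m%:R by rewrite hM divr_gt0.
have := cube_dist hm0 hx' hc; rewrite hM => dx.
exists (h^-1 *: (x' - x)); split.
  by rewrite scalerA divff ?gt_eqF// scale1r addrC subrK.
have -> : h^-1 *: (x' - x) - y = h^-1 *: (x' - (x + h *: y)).
  by rewrite opprD addrA [RHS]scalerBr scalerA mulVf ?gt_eqF// scale1r.
rewrite normrZ gtr0_norm ?invr_gt0// ler_pdivrMl//.
apply: le_trans (ltW dx) _; rewrite ler_pM2l// lef_pV2 ?posrE//.
by rewrite ME; have : 0 < k.+1%:R :> R by []; lra.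
Qed.

(** The sum of the gradients is Lipschitz on [Gam] and covers a ball of slopes, so contact points
    with slopes in a grid of spacing [s1/L] are separated by a multiple of [1/L]. Counting yields
    centres and scales at which the rescaled contact sets become dense, as [jets_lim] requires. *)
Lemma contact_blowup D Gam U G (rho s1 : R) : 0 < rho -> 0 < s1 ->
  D = [set z | `|z| < 4 * rho] -> jets A K D Gam U G ->
  (forall x, Gam x -> `|x| < rho) ->
  (forall q, `|q| <= s1 -> exists2 x, Gam x & G true x + G false x = q) ->
  exists U' G', entire A K U' G'.
Proof.
move=> rho0 s10 DE J Grho onto.
have Drho z : `|z| < 4 * rho -> D z by rewrite DE.
pose C := 3 * K * n.+1%:R.
have C0 : 0 <= C by rewrite !mulr_ge0.
have lip x y : Gam x -> Gam y ->
    `|(G true x + G false x) - (G true y + G false y)| <= 2 * C * `|x - y|.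
  move=> Gx Gy; have hx := Grho _ Gx; have hy := Grho _ Gy.
  have xy : `|x - y| < 2 * rho by have := ler_normB x y; lra.
  have h i : `|G i x - G i y| <= C * `|x - y|.
    apply: (@jets_lipschitz _ _ _ _ _ _ _ _ _ _ _ _ K0 J) => //.
      by apply: Drho; lra.
    move=> z zy; apply: Drho; rewrite -[z](subrK y).
    by have := ler_normD (z - y) y; lra.
  have -> : G true x + G false x - (G true y + G false y) =
    (G true x - G true y) + (G false x - G false y) by rewrite opprD addrACA.
  by have := ler_normD (G true x - G true y) (G false x - G false y);
     have := h true; have := h false; lra.
pose s := 2 * rho; have s0 : 0 < s by rewrite mulr_gt0.
pose a : 'rV[R]_n := \row_i (- rho).
have Ga x : Gam x -> cube a s x.
  move=> /Grho xr i; rewrite mxE /s.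
  by have := le_lt_trans (le_coord_norm x i) xr; rewrite ltr_norml => /andP[? ?];
    apply/andP; split; lra.
(* [T] absorbs the Lipschitz constant: separation [s1 / (2 C L)] is at least [s / (T L)]. *)
pose T := (Num.truncn (s * (2 * C) / s1)).+1.
have TP : s * (2 * C) <= T%:R * s1.
  by rewrite -ler_pdivrMr// /T ltW// truncnS_gt.
have dense m : (1 < m)%N -> exists a' s', [/\ 0 < s', s' <= s &
    forall c : {ffun 'I_n -> 'I_m}, exists2 x, Gam x &
      cube (subcube_corner a' s' c) (s' / m%:R) x].
  move=> m1; apply: (@dense_cube_of_expansion _ _ Gam a s T m) => // L L0.
  have L0R : 0 < L%:R :> R by rewrite ltr0n.
  pose q (j : {ffun 'I_n -> 'I_L}) : 'rV[R]_n := \row_i ((j i)%:R * (s1 / L%:R)).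
  have qs j : `|q j| <= s1.
    apply: norm_coord_le => [|i]; first exact: ltW.
    rewrite mxE ger0_norm; last by rewrite mulr_ge0// divr_ge0// ltW.
    rewrite mulrA ler_pdivrMr// mulrC ler_pM2l// ler_nat.
    exact: ltnW.
  have hpos j : exists x, Gam x /\ G true x + G false x = q j.
    by have [x ? ?] := onto _ (qs j); exists x.
  have [pos posP] := choice hpos.
  exists pos; split=> [j|i j ij].
    by have [h _] := posP j; split => //; exact: Ga.
  have qij : s1 / L%:R <= `|q i - q j|.
    have [l hl] : exists l, i l != j l.
      by apply/existsP; apply: contraR ij => /existsPn h; apply/eqP/ffunP => l;
         apply/eqP; have := h l; rewrite negbK.
    apply: le_trans (le_coord_norm _ l); rewrite !mxE -mulrBl normrM.
    rewrite [X in _ <= _ * X]gtr0_norm ?divr_gt0// ler_peMl//.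
      by rewrite divr_ge0// ltW.
    move: hl; rewrite -(inj_eq val_inj) /= neq_ltn => /orP[] h.
      rewrite distrC ger0_norm ?subr_ge0 ?ler_nat; last exact: ltnW.
      by rewrite -natrB ?(ltnW h)// ler1n subn_gt0.
    rewrite ger0_norm ?subr_ge0 ?ler_nat; last exact: ltnW.
    by rewrite -natrB ?(ltnW h)// ler1n subn_gt0.
  have [Gi Ei] := posP i; have [Gj Ej] := posP j.
  have := lip _ _ Gi Gj; rewrite Ei Ej => h.
  have h' : s1 / L%:R <= 2 * C * `|pos i - pos j| := le_trans qij h.
  have h1 : s1 <= 2 * C * `|pos i - pos j| * L%:R by rewrite -ler_pdivrMr.
  have TL0 : 0 < (T * L)%:R :> R by rewrite ltr0n muln_gt0.
  rewrite ler_pdivrMr// -(ler_pM2r s10) natrM.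
  apply: (@le_trans _ _ (s * (2 * C) * (`|pos i - pos j| * L%:R))).
    have -> : s * (2 * C) * (`|pos i - pos j| * L%:R) =
      s * (2 * C * `|pos i - pos j| * L%:R) by ring.
    by rewrite ler_pM2l.
  apply: (@le_trans _ _ (T%:R * s1 * (`|pos i - pos j| * L%:R))).
    by rewrite ler_wpM2r// mulr_ge0// ltW.
  by rewrite le_eqVlt; apply/orP; left; apply/eqP; ring.
have [xh xhP] := choice (fun k => dense_scale k s0 dense).
have {xhP}[h xhP] := choice xhP.
have [F [UF sF]] := @ultraFilterLemma nat \oo _.
have FF : Filter F by exact: @filter_filter _ _ (@ultra_proper _ _ UF).
have large (t : R) : \forall k \near F, t <= k.+1%:R.
  apply: sF; exists (Num.truncn t) => // k /= tk.
  by rewrite (le_trans (ltW (truncnS_gt t)))// ler_nat.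
(* The value 0 is a default for the finitely many [k] at which [w.1] lies outside the controlled
   ball. *)
have hY (w : 'rV[R]_n * nat) : exists y', `|w.1| <= w.2.+1%:R / 2 ->
    Gam (xh w.2 + h w.2 *: y') /\ `|y' - w.1| <= w.2.+1%:R^-1.
  have [yk|yk] := pselect (`|w.1| <= w.2.+1%:R / 2); last by exists 0.
  by have [_ _ _ /(_ _ yk)[y' hy']] := xhP w.2; exists y'.
have [Y YP] := choice hY.
have nearY y : \forall k \near F, Gam (xh k + h k *: Y (y, k)) /\
    `|Y (y, k) - y| <= k.+1%:R^-1.
  by apply: filterS (large (2 * `|y|)) => k hk; apply: (YP (y, k)) => /=; lra.
have h0 k : 0 < h k by have [] := xhP k.
have JR k := jets_rescale (xh k) (h0 k) J.
have [||||||U' [G' [J' U'0 G'0 _]]] := @jets_lim _ _ A K F UF _ _ _ _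
  (fun y k => Y (y, k)) K0 Acl JR.
- by move=> k /=; rewrite scaler0 addr0; have [] := xhP k.
- by move=> k i; rewrite /rsU scaler0 addr0 dot0r mulr0 subr0 subrr mul0r.
- by move=> k i; rewrite /rsG scaler0 addr0 subrr scaler0.
- move=> t; apply: filterS (large t) => k tk z zt /=; apply: Drho.
  have [Gx _ hk _] := xhP k; have := Grho _ Gx.
  have : `|h k *: z| <= s.
    rewrite normrZ gtr0_norm//.
    apply: (@le_trans _ _ (s / k.+1%:R * k.+1%:R)).
      by apply: ler_pM => //; [exact: ltW|exact: le_trans tk].
    by rewrite divfK ?pnatr_eq0.
  by have := ler_normD (xh k) (h k *: z); rewrite /s; lra.
- move=> y; apply/cvgrPdist_le => e e0.
  apply: (filterS2 _ _ (large (e^-1)) (nearY y)) => k ek [_ hk].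
  by rewrite distrC (le_trans hk)// -[leRHS]invrK lef_pV2// posrE ?invr_gt0.
- by move=> y; apply: filterS (nearY y) => k [].
by exists U', G'; split.
Qed.

End Blowup.

(** * Sup-convolution and the theorem on sums *)

Section SupConvolution.
Context {R : realType} {n : nat}.
Implicit Types (x y z q : 'rV[R]_n) (u : 'rV[R]_n -> R).

(** [Y] selects a point at which the supremum defining the sup-convolution [U] is attained. *)
Record supconv (r : R) u (c : R) (Y : 'rV[R]_n -> 'rV[R]_n) (U : 'rV[R]_n -> R) : Prop :=
  SupConv {
  supconv_norm : forall x, `|Y x| <= r ;
  supconvE : forall x, U x = u (Y x) - c * dot (x - Y x) (x - Y x) ;
  supconv_ge : forall x y, `|y| <= r -> u y - c * dot (x - y) (x - y) <= U x }.

Lemma supconv_exists (r : R) u c : 0 <= r ->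
  (forall x, `|x| <= r -> {for x, continuous u}) ->
  exists Y U, supconv r u c Y U.
Proof.
move=> r0 cu.
have hY x : exists w, `|w| <= r /\ forall y, `|y| <= r ->
    u y - c * dot (x - y) (x - y) <= u w - c * dot (x - w) (x - w).
  have [y yr|w [wr hw]] := @box_max _ _ 0 r (fun y => u y - c * dot (x - y) (x - y)) r0.
    rewrite subr0 in yr; apply: cvgB; first exact: cu.
    have h : (fun y => x - y) @ y --> x - y.
      by apply: cvg_subr; [exact: cvg_cst|exact: cvg_id].
    by apply: cvgMr; exact: cvg_dot.
  by exists w; rewrite subr0 in wr; split => // y yr; apply: hw; rewrite subr0.
have [Y YP] := choice hY.
exists Y, (fun x => u (Y x) - c * dot (x - Y x) (x - Y x)); split => //.
  by move=> x; have [] := YP x.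
by move=> x y yr; have [_ h] := YP x; exact: h.
Qed.

Section Properties.
Variables (r : R) (u : 'rV[R]_n -> R) (c : R).
Variables (Y : 'rV[R]_n -> 'rV[R]_n) (U : 'rV[R]_n -> R).
Hypothesis c0 : 0 < c.
Hypothesis S : supconv r u c Y U.

(** The gradient at [x] of the paraboloid with vertex [Y x], which touches [U] from below at [x]. *)
Definition supconv_slope x : 'rV[R]_n := (2 * c) *: (Y x - x).

Lemma supconv_semiconvex x z :
  U x + dot (supconv_slope x) (z - x) - c * dot (z - x) (z - x) <= U z.
Proof.
have := supconv_ge S z (supconv_norm S x); rewrite (supconvE S x).
apply: le_trans; rewrite le_eqVlt; apply/orP; left; apply/eqP.
rewrite /supconv_slope !dotL (dotC (Y x) x) (dotC (Y x) z) (dotC z x); ring.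
Qed.

(** Semiconvexity at [x] and at [z] bounds [U z - U x] from both sides, with slopes that are locally
    bounded. *)
Lemma supconv_continuous : continuous U.
Proof.
move=> x.
have r0 : 0 <= r := le_trans (normr_ge0 _) (supconv_norm S x).
have slope z : `|supconv_slope z| <= 2 * c * (r + `|z|).
  rewrite normrZ gtr0_norm ?mulr_gt0// ler_pM2l ?mulr_gt0//.
  by rewrite (le_trans (ler_normB _ _))// lerD2r; exact: (supconv_norm S).
pose b z := n%:R * (2 * c * (r + `|x| + `|z|) * `|z - x|) + c * dot (z - x) (z - x).
have half (w v z : 'rV[R]_n) : `|w| <= 2 * c * (r + `|x| + `|z|) -> `|v| = `|z - x| ->
    `|dot w v| <= n%:R * (2 * c * (r + `|x| + `|z|) * `|z - x|).
  move=> hw hv; apply: le_trans (dot_le_norm _ _) _.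
  by apply: ler_wpM2l => //; rewrite hv; exact: ler_wpM2r.
have bU z : `|U z - U x| <= b z.
  have h1 := supconv_semiconvex x z; have h2 := supconv_semiconvex z x.
  have k1 : `|dot (supconv_slope x) (z - x)| <= n%:R * (2 * c * (r + `|x| + `|z|) * `|z - x|).
    apply: half => //; apply: le_trans (slope x) _.
    by rewrite ler_pM2l ?mulr_gt0// lerDl.
  have k2 : `|dot (supconv_slope z) (x - z)| <= n%:R * (2 * c * (r + `|x| + `|z|) * `|z - x|).
    apply: half; last by rewrite distrC.
    apply: le_trans (slope z) _.
    by rewrite ler_pM2l ?mulr_gt0// addrAC lerDl.
  have E : dot (x - z) (x - z) = dot (z - x) (z - x) by rewrite -opprB !dotL; ring.
  rewrite E in h2; rewrite /b.
  move: k1 k2; rewrite !ler_norml => /andP[? ?] /andP[? ?].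
  by apply/andP; split; lra.
have xx : (fun z : 'rV[R]_n => z) @ x --> x by exact: cvg_id.
have cx : (fun z : 'rV[R]_n => x) @ x --> x by exact: cvg_cst.
have b0 : b @ x --> (0 : R).
  have h : b @ x --> n%:R * (2 * c * (r + `|x| + `|x|) * `|x - x|) + c * dot (x - x) (x - x).
    apply: cvgD; last by apply: cvgMr; apply: cvg_dot; exact: cvg_subr.
    apply: cvgMr; apply: cvgM; last by apply: cvg_norm; exact: cvg_subr.
    by apply: cvgMr; apply: cvgD; [exact: cvg_cst|exact: cvg_norm].
  by rewrite subrr normr0 dot0l !mulr0 addr0 in h.
have d0 : (fun z => U z - U x) @ x --> (0 : R).
  by apply: cvg0_le b0; exact: nearW.
have h : (fun z => U z - U x + U x) @ x --> 0 + U x by apply: cvgD => //; exact: cvg_cst.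
rewrite add0r in h; apply: cvg_trans h; apply: near_eq_cvg.
by apply: nearW => z; rewrite subrK.
Qed.

(** Translation by [Y x - x] keeps the penalty constant, so a polynomial touching [U] at [x] touches
    [u] at [Y x] after translation, with the same slope and Hessian. *)
Lemma supconv_subsol (A : 'M[R]_n -> Prop) (D : set 'rV[R]_n) :
  (forall x, D x -> `|Y x| < r) ->
  subsol A [set x | `|x| < r] u -> subsol A D U.
Proof.
move=> Dr Hu x p T e Dx e0 sT H.
have Yr := Dr _ Dx.
pose d := Num.min e (r - `|Y x|).
have d0 : 0 < d by rewrite lt_min e0 subr_gt0.
apply: (Hu (Y x) p T d Yr d0 sT) => y; rewrite /d lt_min => /andP[ye yr].
have yr' : `|y| <= r.
  rewrite -[y](subrK (Y x)); apply: le_trans (ler_normD _ _) _; lra.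
have := H (x + (y - Y x)); rewrite addrAC subrr add0r => /(_ ye).
have := supconv_ge S (x + (y - Y x)) yr'; rewrite (supconvE S x).
have -> : x + (y - Y x) - y = x - Y x by rewrite addrA addrAC addrK.
lra.
Qed.

End Properties.

End SupConvolution.

(** * The theorem on sums *)

Section Sums.
Context {R : realType} {n : nat} (A : bool -> 'M[R]_n -> Prop).
Hypothesis Acl : forall i, symmx_closed (A i).
Implicit Types (x y z q : 'rV[R]_n).
Variables (u : bool -> 'rV[R]_n -> R) (r eta : R).
Hypothesis r0 : 0 < r.
Hypothesis eta0 : 0 < eta.
Hypothesis cu : forall i x, `|x| <= r -> {for x, continuous (u i)}.
Hypothesis su : forall i, subsol (A i) [set x | `|x| < r] (u i).
Hypothesis umax : forall x, `|x| <= r ->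
  u true x + u false x <= u true 0 + u false 0 - eta * dot x x.

Let w0 : R := u true 0 + u false 0.

(** If every [c] failed, there would be bad points for [c = k + 1]; along an ultrafilter they and
    their maximizers [Y] converge to one point, which contradicts the strict maximum of the sum at
    0. *)
Lemma supconv_localized : exists (c : R) (Y : bool -> 'rV[R]_n -> 'rV[R]_n)
    (U : bool -> 'rV[R]_n -> R), [/\ 0 < c, forall i, supconv r (u i) c (Y i) (U i),
  forall i x, `|x| <= r / 2 -> `|Y i x| < r &
  forall x, r / 8 <= `|x| -> `|x| <= r / 2 ->
    U true x + U false x < w0 - eta * r ^+ 2 / 128].
Proof.
have r0' := r0; apply: contrapT => Hno.
have hYU (w : nat * bool) : exists YU : ('rV[R]_n -> 'rV[R]_n) * ('rV[R]_n -> R),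
    supconv r (u w.2) w.1.+1%:R YU.1 YU.2.
  have [Y [U h]] := @supconv_exists _ _ r (u w.2) w.1.+1%:R (ltW r0) (@cu w.2).
  by exists (Y, U).
have [YU YUP] := choice hYU.
have hx k : exists x, [/\ `|x| <= r / 2 &
  (exists i, r <= `|(YU (k, i)).1 x|) \/
  (r / 8 <= `|x| /\ w0 - eta * r ^+ 2 / 128 <= (YU (k, true)).2 x + (YU (k, false)).2 x)].
  apply: contrapT => /forallNP h; apply: Hno.
  exists k.+1%:R, (fun i => (YU (k, i)).1), (fun i => (YU (k, i)).2); split => //.
  - by move=> i; exact: (YUP (k, i)).
  - move=> i x xr; rewrite ltNge; apply/negP => ir; apply: (h x); split => //.
    by left; exists i.
  - move=> x x1 x2; rewrite ltNge; apply/negP => ir; apply: (h x); split => //.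
    by right.
have [X XP] := choice hx.
have [F [UF sF]] := @ultraFilterLemma nat \oo _.
have FF : Filter F by exact: @filter_filter _ _ (@ultra_proper _ _ UF).
have : X @ F --> lim (X @ F).
  by apply: (@ultra_cvg_rV _ _ _ _ _ _ (r / 2)); apply: nearW => k; have [] := XP k.
move: (lim _) => xs Xxs.
have nX : (fun k => `|X k|) @ F --> `|xs| by exact: cvg_norm.
have xsr : `|xs| <= r / 2.
  by apply: (ler_cvg_to nX (cvg_cst (r / 2))); apply: nearW => k; have [] := XP k.
have bnd i : exists M, forall x, `|x| <= r -> `|u i x| <= M.
  have hb y : `|y - 0| <= r -> {for y, continuous (u i)} by rewrite subr0; exact: cu.
  have [w [_ hw]] := @box_max _ _ 0 r (u i) (ltW r0) hb.
  have [y yr|v [_ hv]] := @box_max _ _ 0 r (fun x => - u i x) (ltW r0).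
    by apply: cvgN; exact: hb.
  exists (`|u i w| + `|u i v|) => x xr.
  have := hw x; have := hv x; rewrite /= subr0 => /(_ xr) h1 /(_ xr) h2.
  have := ler_norm (u i w); have := ler_norm (- u i v); rewrite normrN => h3 h4.
  have := normr_ge0 (u i w); have := normr_ge0 (u i v) => h5 h6.
  by rewrite ler_norml; apply/andP; split; lra.
pose Yk i k := (YU (k, i)).1 (X k).
have h0 : (fun k => k.+1%:R^-1) @ F --> (0 : R).
  by move=> B hB; apply: sF; exact: (@cvg_harmonic R).
have Xr k : `|X k| <= r.
  by have [h _] := XP k; apply: le_trans h _; lra.
(* The functions are bounded by some [M], so the penalty [c |X - Y|^2] is at most [2 M] while [c]
   tends to infinity. *)
have YX i : Yk i @ F --> xs.
  have [M hM] := bnd i.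
  have d0 : (fun k => dot (X k - Yk i k) (X k - Yk i k)) @ F --> (0 : R).
    apply: (@cvg0_le _ _ _ _ _ (fun k => 2 * M * k.+1%:R^-1)); last first.
      by rewrite -(mulr0 (2 * M)); exact: cvgMr.
    apply: nearW => k; rewrite ger0_norm ?dot_ge0//.
    have S := YUP (k, i); have := supconv_ge S (X k) (Xr k).
    rewrite (supconvE S) /= subrr dot0l mulr0 subr0 => h.
    have := hM _ (Xr k); have := hM _ (supconv_norm S (X k)).
    rewrite !ler_norml => /andP[? ?] /andP[? ?].
    by rewrite -/(Yk i k) in h *; rewrite ler_pdivlMr ?ltr0n// mulrC; lra.
  have e0 : (fun k => X k - Yk i k) @ F --> (0 : 'rV[R]_n).
    apply: cvg_rV => j; rewrite mxE; apply/cvgrPdist_lt => e e0.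
    have e2 : 0 < e ^+ 2 by rewrite exprn_gt0.
    move/cvgrPdist_lt : d0 => /(_ _ e2); apply: filterS => k.
    rewrite !sub0r !normrN ger0_norm ?dot_ge0// => h.
    rewrite -(@ltr_pXn2r _ 2)// ?nnegrE ?(ltW e0)//.
    apply: le_lt_trans h; apply: le_trans (norm_sqr_le _).
    by rewrite ler_pXn2r ?nnegrE//; exact: le_coord_norm.
  have h : (fun k => X k - (X k - Yk i k)) @ F --> xs - 0 by exact: cvg_subr.
  rewrite subr0 in h; apply: cvg_trans h; apply: near_eq_cvg.
  by apply: nearW => k; rewrite opprB addrC subrK.
have nY i : \forall k \near F, `|Yk i k| < r.
  have r4 : 0 < r / 4 by rewrite divr_gt0.
  apply: filterS (cvg_near_ball r4 (YX i)) => k h.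
  rewrite -[Yk i k](subrK xs); apply: le_lt_trans (ler_normD _ _) _; lra.
have nS : \forall k \near F, r / 8 <= `|X k| /\
    w0 - eta * r ^+ 2 / 128 <= u true (Yk true k) + u false (Yk false k).
  apply: (filterS2 _ _ (nY true) (nY false)) => k y1 y2.
  have [_ [[i]|[h1 h2]]] := XP k.
    by case: i; rewrite -/(Yk _ k) leNgt ?y1 ?y2.
  split => //; apply: le_trans h2 _.
  have hd i : (YU (k, i)).2 (X k) <= u i (Yk i k).
    rewrite (supconvE (YUP (k, i))) /= gerBl.
    by rewrite mulr_ge0// dot_ge0.
  by have := hd true; have := hd false; lra.
have xs8 : r / 8 <= `|xs|.
  by apply: (ler_cvg_to (cvg_cst (r / 8)) nX); apply: filterS nS => k [].
have xsr' : `|xs| <= r by lra.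
have lim2 : w0 - eta * r ^+ 2 / 128 <= u true xs + u false xs.
  have c1 : (fun k => u true (Yk true k) + u false (Yk false k)) @ F -->
      u true xs + u false xs.
    have ci i : (fun k => u i (Yk i k)) @ F --> u i xs.
      by apply: (@cvg_comp _ _ _ (Yk i) (u i)) (YX i) _; exact: (@cu i xs xsr').
    by apply: cvgD; exact: ci.
  by apply: (ler_cvg_to (cvg_cst _) c1); apply: filterS nS => k [].
(* At distance at least [r/8] the strict maximum costs [eta r^2 / 64], twice what the limit
   allows. *)
have := umax xsr'; rewrite -/w0 => lim3.
have : r ^+ 2 / 64 <= dot xs xs.
  apply: le_trans (norm_sqr_le _).
  have -> : r ^+ 2 / 64 = (r / 8) ^+ 2 by field.
  by rewrite ler_pXn2r ?nnegrE//; lra.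
have e1 : 0 < eta * r ^+ 2 by rewrite mulr_gt0// exprn_gt0.
rewrite -(ler_pM2l eta0) mulrA; lra.
Qed.

(** The drop on the shell keeps the maximum of the sup-convolved sum, tilted by a small slope [q],
    inside a small ball. Thus every such [q] is realized by a contact point, and the blow-up
    applies. *)
Theorem touching_hessians_sum_le0 : exists S : bool -> 'M[R]_n,
  [/\ (forall i, (S i)^T = S i), (forall i, A i (S i)) &
   forall y, qf (S true) y + qf (S false) y <= 0].
Proof.
have r0' := r0; have [c [Y [U [c0 SU Yr shell]]]] := supconv_localized.
have [G sc] : exists G : bool -> 'rV[R]_n -> 'rV[R]_n, forall i x z,
    U i x + dot (G i x) (z - x) - c * dot (z - x) (z - x) <= U i z.
  by exists (fun i => supconv_slope c (Y i)) => i; exact: (supconv_semiconvex (SU i)).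
pose rho := r / 8; have rho0 : 0 < rho by rewrite divr_gt0.
pose D : set 'rV[R]_n := [set z | `|z| < 4 * rho].
pose Gam : set 'rV[R]_n := [set x | `|x| < rho /\ forall z, `|z| < 4 * rho ->
  U true z + U false z <= U true x + U false x + dot (G true x + G false x) (z - x)].
have J : jets A c D Gam U G.
  split.
  (* Each function is bounded below by semiconvexity; the upper bound of the sum then bounds the
     other one from above. *)
  - have key x z : Gam x -> D z -> forall i, `|U i z - U i x - dot (G i x) (z - x)| <=
       c * dot (z - x) (z - x).
      move=> [_ hx] Dz i; have := hx z Dz.
      have h1 := sc true x z; have h2 := sc false x z.
      rewrite dotDl ler_norml => h3.
      by case: i; apply/andP; split; lra.
    by move=> i x z Gx Dz; exact: key.
  - by move=> x z [_ hx] Dz; exact: hx.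
  - by move=> i z _; exact: (supconv_continuous c0 (SU i)).
  - move=> i; apply: (supconv_subsol (SU i) _ (@su i)) => x Dx; apply: Yr.
    by move: Dx; rewrite /D /= /rho => h; lra.
have fc : continuous (fun x => U true x + U false x).
  by move=> x; apply: cvgD; exact: (supconv_continuous c0 (SU _)).
(* This makes [|q.x| <= eta r^2 / 256] on the ball of radius [r/2], half of the drop on the
   shell. *)
pose s1 := eta * r / (128 * n.+1%:R).
have n0 : 0 < n.+1%:R :> R by rewrite ltr0n.
have s10 : 0 < s1 by rewrite divr_gt0// mulr_gt0.
have [//||U' [G' E]] := @contact_blowup _ _ A c (ltW c0) Acl D Gam U G rho s1 rho0 s10 erefl J.
- by move=> x [].
- move=> q qs.
  have r20 : 0 <= r / 2 by lra.
  have [x xr|x [xr hx]] := @box_max _ _ 0 (r / 2) (fun x => U true x + U false x - dot q x) r20.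
  - by apply: cvgB; [exact: fc|apply: cvg_dot; [exact: cvg_cst|exact: cvg_id]].
  rewrite subr0 in xr.
  have {}hx z : `|z| <= r / 2 -> U true z + U false z - dot q z <= U true x + U false x - dot q x.
    by move=> zr; apply: hx; rewrite subr0.
  have qx : `|dot q x| <= eta * r ^+ 2 / 256.
    apply: le_trans (dot_le_norm _ _) _.
    apply: (@le_trans _ _ (n%:R * (s1 * (r / 2)))).
      by apply: ler_wpM2l => //; exact: ler_pM.
    rewrite /s1.
    have -> : n%:R * (eta * r / (128 * n.+1%:R) * (r / 2)) =
       n%:R / n.+1%:R * (eta * r ^+ 2 / 256) by field; rewrite addrC natr1 gt_eqF.
    rewrite ler_piMl//; first by rewrite divr_ge0// mulr_ge0 ?sqr_ge0// ltW.
    by rewrite ler_pdivrMr// mul1r ler_nat.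
  have er : 0 < eta * r ^+ 2 by rewrite mulr_gt0// exprn_gt0.
  have f0 : w0 <= U true 0 + U false 0.
    have hi i : u i 0 <= U i 0.
      have := supconv_ge (SU i) 0 (_ : `|0 : 'rV[R]_n| <= r).
      by rewrite normr0 subrr dot0l mulr0 subr0; apply; exact: ltW.
    by have := hi true; have := hi false; rewrite /w0; lra.
  have xrho : `|x| < rho.
    rewrite ltNge; apply/negP => rx; have := shell _ rx xr.
    have := hx 0; rewrite normr0 dot0r => /(_ ltac:(lra)).
    by move: qx; rewrite ler_norml => /andP[]; lra.
  have zD z : `|z| < 4 * rho -> `|z| <= r / 2 by rewrite /rho => h; lra.
  have eq : G true x + G false x = q.
    have [v vE] : exists v, v = G true x + G false x - q by eexists.
    have v0 : 0 <= `|v| / r by rewrite divr_ge0// ltW.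
    (* A step [t v] must not increase the tilted sum. The term [4 c] makes the quadratic loss at
       most half the linear gain [t |v|^2]; the other term keeps the step within [r/8]. *)
    pose t := (4 * c + 8 * (`|v| / r))^-1.
    have tden : 0 < 4 * c + 8 * (`|v| / r) by lra.
    have t0 : 0 < t by rewrite invr_gt0.
    have t1 : t * (4 * c + 8 * (`|v| / r)) = 1 by rewrite mulVf ?gt_eqF.
    have tc : t * (4 * c) <= 1.
      by rewrite -[leRHS]t1 ler_pM2l//; lra.
    have tv : `|t *: v| <= rho.
      rewrite normrZ gtr0_norm// /rho ler_pdivlMr// -[leRHS]mul1r -ler_pdivrMr//.
      have -> : t * `|v| * 8 / r = t * (8 * (`|v| / r)) by ring.
      by rewrite -[leRHS]t1 ler_pM2l//; lra.
    have xtv : `|x + t *: v| <= r / 2.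
      by apply: le_trans (ler_normD _ _) _; move: tv xrho; rewrite /rho; lra.
    have := hx _ xtv.
    have := sc true x (x + t *: v); have := sc false x (x + t *: v).
    have -> : x + t *: v - x = t *: v by rewrite addrAC subrr add0r.
    rewrite !dotL => h1 h2 h3.
    have E : dot (G true x) v + dot (G false x) v - dot q v = dot v v.
      by rewrite [X in _ = dot X _]vE !dotL.
    have h4 : t * dot v v <= 2 * c * t * (t * dot v v).
      have E' : t * dot (G true x) v + t * dot (G false x) v - t * dot q v = t * dot v v.
        by rewrite -E; ring.
      move: h1 h2 h3 E'. 
      by lra.
    have vv := dot_ge0 v.
    have h5 : 0 <= t * dot v v by rewrite mulr_ge0// ltW.
    have h6 : 2 * c * t * (t * dot v v) <= 2^-1 * (t * dot v v).
      by rewrite ler_wpM2r//; lra.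
    have : t * dot v v = 0 by lra.
    move/eqP; rewrite mulf_eq0 gt_eqF//= => /eqP/dot_eq0/eqP.
    by rewrite vE subr_eq0 => /eqP.
  exists x => //; split => // z /zD zr; rewrite eq !dotL; have := hx _ zr; lra.
exact: entire_sum_le0 (ltW c0) Acl _ _ E.
Qed.

End Sums.

(** * Quadratic test functions and reflected differences *)

Section QuadraticTest.
Context {R : realType} {n : nat}.
Implicit Types (x y w p : 'rV[R]_n) (S : 'M[R]_n).

Definition quad (c : R) p S w : 'rV[R]_n -> R :=
  fun y => c + dot p (y - w) + 2^-1 * qf S (y - w).

Lemma qf0l x : qf 0 x = 0 :> R.
Proof. by rewrite /qf mulmx0 mul0mx mxE. Qed.

Lemma quad_is_derive c p S w x v : S^T = S ->
  derivable (quad c p S w) x v /\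
  'D_v (quad c p S w) x = dot (p + (x - w) *m S) v.
Proof.
move=> sS.
suff h : (fun h : R => h^-1 *: (quad c p S w (h *: v + x) - quad c p S w x)) @ 0^'
    --> dot (p + (x - w) *m S) v.
  split; first by apply/cvg_ex; exists (dot (p + (x - w) *m S) v).
  exact: (cvg_lim (@Rhausdorff R) h).
have h : (fun h : R => dot (p + (x - w) *m S) v + h * (2^-1 * qf S v)) @ 0^'
    --> dot (p + (x - w) *m S) v + 0 * (2^-1 * qf S v).
  apply: cvgD; first exact: cvg_cst.
  by apply: cvgMl; apply: cvg_within_filter; exact: cvg_id.
rewrite mul0r addr0 in h; apply: cvg_trans h; apply: near_eq_cvg.
near=> h.
have h0 : h != 0 by near: h; exact: nbhs_dnbhs_neq.
have E : h *: v + x - w = (x - w) + h *: v by rewrite [h *: v + x]addrC addrAC.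
rewrite /quad E qfDr// qfZ dotDr !dotZr dotDl /GRing.scale /=.
by field.
Unshelve. all: by end_near. Qed.

Lemma dot_mulmx x y S : dot (x *m S) y = dot x (y *m S^T).
Proof. by rewrite /dot trmx_mul trmxK mulmxA. Qed.

(** The affine derivative is written as a [quad] with zero Hessian, so that second derivatives
    follow from the same formula. *)
Lemma partial_quad c p S w i : S^T = S ->
  partial i (quad c p S w) = quad (p 0 i) (delta_mx 0 i *m S) 0 w.
Proof.
move=> sS; apply/funext => x; rewrite /partial (quad_is_derive _ _ _ _ _ sS).2.
rewrite /quad dotDl dot_delta.
rewrite qf0l mulr0 addr0.
by rewrite dot_mulmx sS dotC.
Qed.

Lemma quad_C1 c p S w x : S^T = S -> C1_at (quad c p S w) x.
Proof.
move=> sS; split; first exact: quad_continuous.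
move=> i; split; first exact: (quad_is_derive _ _ _ _ _ sS).1.
by rewrite partial_quad//; exact: quad_continuous.
Qed.

Lemma near_norm x (P : 'rV[R]_n -> Prop) (r : R) : 0 < r ->
  (forall y, `|y - x| < r -> P y) -> \forall y \near x, P y.
Proof.
move=> r0 H; have xx : (fun z : 'rV[R]_n => z) @ x --> x by exact: cvg_id.
by apply: filterS (cvg_near_ball r0 xx) => y; exact: H.
Qed.

Lemma quad_C2 c p S w x : S^T = S -> C2_near (quad c p S w) x.
Proof.
move=> sS; apply: (near_norm ltr01) => y _; split=> [|i]; first exact: quad_C1.
by rewrite partial_quad//; apply: quad_C1; rewrite trmx0.
Qed.

Lemma hessian_quad c p S w x : S^T = S -> hessian (quad c p S w) x = S.
Proof.
move=> sS; apply/matrixP => i j; rewrite mxE partial_quad// partial_quad ?trmx0//.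
by rewrite /quad mulmx0 dot0l qf0l mulr0 !addr0 -rowE mxE.
Qed.

Lemma viscosity_subsol (F : 'M[R]_n -> R) Omega u :
  viscosity_solution F Omega u -> subsol (fun S => 0 <= F S) Omega u.
Proof.
move=> [_ H] x p S r Ox r0 sS hu.
have [h _] := H x (quad (u x) p S x) Ox (quad_C2 (u x) p x x sS).
rewrite -(hessian_quad (u x) p x x sS); apply: h.
apply: near_norm r0 _ => y /hu.
by rewrite /quad subrr dot0r qf0; lra.
Qed.

Lemma viscosity_supersol (F : 'M[R]_n -> R) Omega u x p S r :
  viscosity_solution F Omega u -> Omega x -> 0 < r -> S^T = S ->
  (forall y, `|y - x| < r -> u x + dot p (y - x) + 2^-1 * qf S (y - x) <= u y) ->
  F S <= 0.
Proof.
move=> [_ H] Ox r0 sS hu.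
have [_ h] := H x (quad (u x) p S x) Ox (quad_C2 (u x) p x x sS).
rewrite -(hessian_quad (u x) p x x sS); apply: h.
apply: near_norm r0 _ => y /hu.
by rewrite /quad subrr dot0r qf0; lra.
Qed.

End QuadraticTest.

(** * Quadratic contact from above for a solution minus its reflection *)

Section ReflectedDifference.
Context {R : realType} {n : nat}.
Variables (F : 'M[R]_n -> R) (Omega : set 'rV[R]_n) (u : 'rV[R]_n -> R).
Implicit Types (x y h : 'rV[R]_n).

Lemma elliptic_perturb : uniformly_elliptic F -> exists2 C : R, 1 <= C &
  (forall M N, M^T = M -> nonneg_definite N -> C^-1 * `|N| <= F (M + N) - F M) /\
  (forall M (eps : R), M^T = M -> 0 <= eps -> F (M + eps%:M) <= F M + C * eps).
Proof.
move=> [C C1 H]; exists C => //; split.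
  by move=> M N sM hN; have /andP[] := H M N sM hN.
move=> M eps sM eps0.
have hN : nonneg_definite (eps%:M : 'M[R]_n).
  split; first by rewrite tr_scalar_mx.
  by move=> v; rewrite -/(qf _ _) -scalemx1 qfZl qf1 mulr_ge0// dot_ge0.
have /andP[_ h] := H M _ sM hN.
rewrite -lerBlDl; apply: le_trans h _; rewrite ler_wpM2l//; first by lra.
rewrite [leLHS]/Num.norm /= mx_normrE.
apply/bigmax_leP; split => // -[i j] _ /=; rewrite !mxE.
by case: (i == j); rewrite ?mulr1n ?mulr0n ?normr0// ger0_norm.
Qed.

Hypothesis Fell : uniformly_elliptic F.
Hypothesis Fhess : hessian_equation F.
Hypothesis uvisc : viscosity_solution F Omega u.
Variables (O : 'M[R]_n) (x0 p : 'rV[R]_n) (S : 'M[R]_n) (r eta : R).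
Hypothesis Osym : O^T = O.
Hypothesis Oinv : O *m O = 1%:M.
Hypothesis r0 : 0 < r.
Hypothesis eta0 : 0 < eta.
Hypothesis sS : S^T = S.
Hypothesis ucont : forall x, Omega x -> {for x, continuous u}.
Hypothesis Omega_ball : forall h, `|h| <= r -> Omega (x0 + h) /\ Omega ((x0 + h) *m O).
Hypothesis touch : forall h, `|h| <= r ->
  u (x0 + h) - u ((x0 + h) *m O) <=
  u x0 - u (x0 *m O) + dot p h + 2^-1 * qf S h - eta * dot h h.

(** The theorem on sums applies to [u] and to minus the reflected [u] minus the polynomial. It gives
    [T true <= - T false]; with [B = - (T false + S)] the reflected solution yields [F B <= 0], and
    monotonicity yields [0 <= F (T true) <= F (B + S)]. *)
Lemma reflected_difference_touch :
  exists B : 'M[R]_n, [/\ B^T = B, F B <= 0 & 0 <= F (B + S)].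
Proof.
have [C C1 [ell pert]] := elliptic_perturb Fell.
have C0 : 0 < C by lra.
have r0' := r0.
have close (a : R) : (forall eps : R, 0 < eps -> 0 <= a + C * eps) -> 0 <= a.
  move=> ha; apply/ler_addgt0Pr => e e0.
  by have := ha (e / C) (divr_gt0 e0 C0); rewrite mulrC divfK ?gt_eqF.
(* In the second function [u] occurs with a minus sign and the polynomial is subtracted, so [T]
   corresponds to the Hessian [- (T + S)] touching the reflected [u] from below. *)
pose A (i : bool) (T : 'M[R]_n) := if i then 0 <= F T else F (- (T + S)) <= 0.
pose v (i : bool) (h : 'rV[R]_n) : R := if i then u (x0 + h)
  else - u ((x0 + h) *m O) - dot p h - 2^-1 * qf S h.
have OO : O^T *m O = 1%:M by rewrite Osym.
have symN (T : 'M[R]_n) : T^T = T -> (- (T + S))^T = - (T + S).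
  by move=> sT; rewrite linearN /= linearD /= sT sS.
have Acl i : symmx_closed (A i).
  move=> T sT hT; case: i hT => /= hT.
    by apply: close => eps eps0; apply: le_trans (hT _ eps0) (pert _ _ sT (ltW eps0)).
  rewrite -oppr_ge0; apply: close => eps eps0.
  have := pert _ _ (symN (T + eps%:M) _) (ltW eps0).
  rewrite linearD /= sT tr_scalar_mx => /(_ erefl).
  have -> : - (T + eps%:M + S) + eps%:M = - (T + S).
    by rewrite addrAC opprD addrNK.
  by have := hT _ eps0; rewrite /A; lra.
have shift_cvg h : (fun z : 'rV[R]_n => x0 + z) @ h --> x0 + h.
  by apply: cvgD; [exact: cvg_cst|exact: cvg_id].
have vc i h : `|h| <= r -> {for h, continuous (v i)}.
  move=> /Omega_ball[ Om1 Om2]; case: i => /=.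
    apply: (@cvg_comp _ _ _ (fun z => x0 + z) u) (shift_cvg h) _.
    exact: ucont.
  apply: cvgB; last by apply: cvgMr; apply: cvg_qf; exact: cvg_id.
  apply: cvgB; last by apply: cvg_dot; [exact: cvg_cst|exact: cvg_id].
  apply: cvgN; apply: (@cvg_comp _ _ _ (fun z => (x0 + z) *m O) u) _ (ucont Om2).
  by apply: cvg_mulmx; exact: shift_cvg.
have Os i : subsol (A i) [set h | `|h| < r] (v i).
  move=> x q T e xr e0 sT H; case: i H => /= H.
    have [ Om1 _] := Omega_ball (ltW xr).
    apply: (viscosity_subsol uvisc Om1 e0 sT (p := q)) => y ye.
    have := H (y - x0); rewrite subrKC.
    have -> : y - x0 - x = y - (x0 + x) by rewrite opprD addrA.
    exact.
  have [_ Om2] := Omega_ball (ltW xr).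
  have sM := symN T sT; set M := - (T + S) in sM.
  have sOM : (O *m M *m O^T)^T = O *m M *m O^T.
    by rewrite !trmx_mul trmxK sM mulmxA.
  have -> : F (- (T + S)) = F (O *m M *m O^T).
    by rewrite Osym -/M -(Fhess sM OO) Osym.
  (* The reflection preserves the Euclidean norm only; the factor [n + 1] pays for the max-entry
     norm. *)
  have e'0 : 0 < e / n.+1%:R by rewrite divr_gt0// ltr0n.
  apply: (viscosity_supersol (p := (- (q + p + x *m S)) *m O) uvisc Om2 e'0 sOM) => y ye.
  pose k := (y - (x0 + x) *m O) *m O.
  have kO : (x0 + (x + k)) *m O = y.
    by rewrite addrA mulmxDl /k -mulmxA Oinv mulmx1 subrKC.
  have ke : `|k| < e.
    apply: (@le_lt_trans _ _ (n.+1%:R * `|y - (x0 + x) *m O|)); last first.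
      by rewrite mulrC -ltr_pdivlMr ?ltr0n.
    rewrite -(@ler_pXn2r _ 2)// ?nnegrE ?mulr_ge0//.
    apply: le_trans (norm_sqr_le _) _.
    rewrite /k dot_mulmx Osym -mulmxA Oinv mulmx1.
    apply: le_trans (dot_sqr_le _) _; rewrite exprMn ler_wpM2r ?sqr_ge0//.
    by rewrite -natrX ler_nat; nia.
  have := H (x + k); rewrite [x + k - x]addrAC subrr add0r => /(_ ke).
  rewrite kO dotDr (qfDr _ _ sS).
  have -> : dot (- (q + p + x *m S) *m O) (y - (x0 + x) *m O) =
      - dot q k - dot p k - dot (x *m S) k.
    by rewrite dot_mulmx Osym -/k !dotNl !dotDl; ring.
  have -> : qf (O *m M *m O^T) (y - (x0 + x) *m O) = - qf T k - qf S k.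
    by rewrite -qf_conj -/k /M qfNl qfDl opprD.
  lra.
have [h hr|T [sT AT T0]] := @touching_hessians_sum_le0 _ _ A Acl v r eta r0 eta0 vc Os.
  have := touch hr; rewrite /v !addr0 dot0r qf0 => th; lra.
exists (- (T false + S)); split.
- exact: symN.
- exact: AT false.
have -> : - (T false + S) + S = - T false by rewrite opprD addrNK.
have := AT true; rewrite /A => h; apply: le_trans h _.
have hN : nonneg_definite (- T false - T true).
  split; first by rewrite linearB linearN /= !sT.
  move=> w; have := T0 w; rewrite -/(qf _ _) qfDl !qfNl; lra.
have := ell _ _ (sT true) hN.
have -> : T true + (- T false - T true) = - T false by rewrite addrCA subrr addr0.
have : 0 <= C^-1 * `|- T false - T true| by rewrite mulr_ge0// invr_ge0 ltW.
lra.
Qed.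

End ReflectedDifference.

(** * The barrier *)

Section PowerBounds.
Context {R : realType}.

(** Bernoulli's inequality for real exponents. The bound [1 + x <= exp x] at [ln s - ln m] and at
    [- ln m], averaged with weights [beta] and [1 - beta], gives [beta ln s <= ln m], since
    [beta s + (1 - beta) = m]. *)
Lemma powR_le_affine (s beta : R) : 0 < s -> 0 <= beta <= 1 ->
  s `^ beta <= 1 + beta * (s - 1).
Proof.
move=> s0 /andP[b0 b1]; set m := 1 + _.
have bs : 0 <= beta * s by rewrite mulr_ge0// ltW.
have m0 : 0 < m.
  have [be|bn] := eqVneq beta 1; first by rewrite /m be; lra.
  have : beta < 1 by rewrite lt_neqAle bn.
  by rewrite /m; lra.
rewrite /powR gt_eqF// -[leRHS]lnK ?posrE// ler_expR.
have h1 := expR_ge1Dx (ln s - ln m); have h2 := expR_ge1Dx (0 - ln m).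
rewrite expRB !lnK ?posrE// in h1; rewrite expRB expR0 lnK ?posrE// in h2.
have e1 : beta * (s / m) + (1 - beta) * (1 / m) = 1.
  have -> : beta * (s / m) + (1 - beta) * (1 / m) = m / m by rewrite /m; ring.
  by rewrite divff// gt_eqF.
have k1 : beta * (1 + (ln s - ln m)) <= beta * (s / m) by rewrite ler_wpM2l.
have k2 : (1 - beta) * (1 + (0 - ln m)) <= (1 - beta) * (1 / m).
  by rewrite ler_wpM2l// subr_ge0.
lra.
Qed.

Lemma sqrt_le_quad (z : R) : `|z| <= 2^-1 ->
  Num.sqrt (1 + z) <= 1 + z / 2 - z ^+ 2 / 16.
Proof.
rewrite ler_norml => /andP[z1 z2].
have zz : z ^+ 2 <= 1.
  have : 0 <= (2^-1 - z) * (2^-1 + z) by rewrite mulr_ge0//; lra.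
  by rewrite expr2; lra.
have b0 : 0 <= 1 + z / 2 - z ^+ 2 / 16 by lra.
rewrite -[leRHS]ger0_norm// -sqrtr_sqr ler_wsqrtr//.
have := sqr_ge0 z => z0.
have h : 0 <= z ^+ 2 * (2 - z) by rewrite mulr_ge0//; lra.
have -> : (1 + z / 2 - z ^+ 2 / 16) ^+ 2 = 1 + z + z ^+ 2 * (2 - z) / 16 + (z ^+ 2 / 16) ^+ 2.
  by field.
have := sqr_ge0 (z ^+ 2 / 16); lra.
Qed.

(** Strict concavity near 1 is taken from the square root: [(1 + z)^alpha] is [s^(2 alpha)] with
    [s = sqrt (1 + z)]. Bernoulli applies to the exponent [2 alpha] if it is at most 1, and
    otherwise to the second factor of [s s^(2 alpha - 1)]. *)
Lemma powR_le_quad (alpha : R) : 0 < alpha < 1 -> exists2 kappa : R, 0 < kappa &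
  forall z, `|z| <= 2^-1 -> (1 + z) `^ alpha <= 1 + alpha * z - kappa * z ^+ 2.
Proof.
move=> /andP[a0 a1].
have sP (z : R) : `|z| <= 2^-1 -> 0 < 1 + z /\ 0 < Num.sqrt (1 + z).
  by rewrite ler_norml => /andP[? ?]; rewrite sqrtr_gt0; split; lra.
have pw (z : R) : `|z| <= 2^-1 -> (1 + z) `^ alpha = Num.sqrt (1 + z) `^ (2 * alpha).
  move=> /sP[/ltW z0 _]; rewrite -powR12_sqrt// -powRrM.
  by rewrite mulrA mulVf ?mul1r.
have [a2|a2] := leP alpha 2^-1.
  exists (alpha / 8) => [|z zh]; first by rewrite divr_gt0.
  have [z0 s0] := sP z zh; rewrite pw//.
  apply: le_trans (powR_le_affine s0 (_ : 0 <= 2 * alpha <= 1)) _; first by lra.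
  have := sqrt_le_quad zh => h.
  have : 2 * alpha * Num.sqrt (1 + z) <= 2 * alpha * (1 + z / 2 - z ^+ 2 / 16).
    by rewrite ler_pM2l//; lra.
  lra.
exists ((1 - alpha) / 8) => [|z zh]; first by rewrite divr_gt0// subr_gt0.
have [z0 s0] := sP z zh; rewrite pw//.
have -> : 2 * alpha = 1 + (2 * alpha - 1) by ring.
rewrite powRD ?(gt_eqF s0) ?implybT// powRr1 ?(ltW s0)//.
set s := Num.sqrt (1 + z) in s0 *.
have ss : s * s = 1 + z by rewrite -expr2 sqr_sqrtr// ltW.
apply: (@le_trans _ _ (s * (1 + (2 * alpha - 1) * (s - 1)))).
  by rewrite ler_pM2l// powR_le_affine//; lra.
have -> : s * (1 + (2 * alpha - 1) * (s - 1)) =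
  (2 - 2 * alpha) * s + (2 * alpha - 1) * (s * s) by ring.
rewrite ss.
have : (2 - 2 * alpha) * s <= (2 - 2 * alpha) * (1 + z / 2 - z ^+ 2 / 16).
  by rewrite ler_pM2l; [exact: sqrt_le_quad|lra].
lra.
Qed.

End PowerBounds.

Section Barrier.
Context {R : realType} {n : nat}.
Implicit Types (x y e h : 'rV[R]_n).

Lemma euclid_normE x : euclid_norm x = Num.sqrt (dot x x).
Proof. by rewrite /euclid_norm dotE; under eq_bigr do rewrite expr2. Qed.

Lemma punctured_ballE x : punctured_ball x <-> 0 < dot x x < 1.
Proof.
have E : (Num.sqrt (dot x x) < 1) = (dot x x < 1).
  by rewrite -(ltr_sqrt (dot x x) (@ltr01 R)) sqrtr1.
by rewrite /punctured_ball /= euclid_normE sqrtr_gt0 E.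
Qed.

Definition barrier (alpha delta : R) e x : R := (dot x e + delta * euclid_norm x) `^ alpha.

(** The base of the power has value [L] and gradient [q] at [x0], and is at most [L + w] with
    [w = q.h + delta |h|^2]. Concavity of the power gives a negative term in direction [q], while
    all positive curvature carries the factor [delta]. *)
Lemma barrier_le (alpha kappa delta : R) e x0 : 0 < alpha -> 0 < kappa ->
  (forall z, `|z| <= 2^-1 -> (1 + z) `^ alpha <= 1 + alpha * z - kappa * z ^+ 2) ->
  0 < delta -> dot x0 x0 = 4^-1 -> 0 <= dot x0 e ->
  let L := dot x0 e + delta / 2 in let q := e + (2 * delta) *: x0 in
  let m := L `^ alpha / L ^+ 2 in
  exists2 r : R, 0 < r & forall h, `|h| <= r -> 0 <= dot (x0 + h) e ->
    barrier alpha delta e (x0 + h) <= L `^ alpha + dot ((alpha * L * m) *: q) h +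
      m * (2 * alpha * delta * L * dot h h - kappa / 2 * dot q h ^+ 2).
Proof.
move=> a0 k0 hk d0 x00 xe L q m.
have L0 : 0 < L by rewrite /L; lra.
pose c1 := n%:R * (`|q| + delta) + 1.
pose c2 := kappa * delta * n%:R + 1.
have n0 : 0 <= n%:R :> R by [].
have c10 : 0 < c1.
  by have : 0 <= n%:R * (`|q| + delta); [rewrite mulr_ge0// addr_ge0// ltW|rewrite /c1; lra].
have c20 : 0 < c2.
  by have : 0 <= kappa * delta * n%:R; [rewrite !mulr_ge0// ltW|rewrite /c2; lra].
pose r := Num.min 1 (Num.min (L / 2 / c1) (alpha * L / c2)).
have r0 : 0 < r by rewrite !lt_min ltr01 !divr_gt0// mulr_gt0.
exists r => // h hr xhe.
move: hr; rewrite !le_min => /and3P[hr1 hr2 hr3].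
have hh0 := dot_ge0 h.
have hh : dot h h <= n%:R * `|h|.
  apply: le_trans (dot_sqr_le _) _; rewrite ler_wpM2l// expr2 ler_piMr//.
have hh1 : delta * dot h h <= delta * (n%:R * `|h|) by rewrite ler_pM2l.
have qh : `|dot q h| <= n%:R * (`|q| * `|h|) := dot_le_norm q h.
have hc1 : `|h| * c1 <= L / 2 by rewrite -ler_pdivlMr.
have hc2 : `|h| * c2 <= alpha * L by rewrite -ler_pdivlMr.
pose w := dot q h + delta * dot h h.
have wL : `|w| <= L / 2.
  apply: le_trans (ler_normD _ _) _; rewrite [X in _ + X]ger0_norm; last by rewrite mulr_ge0// ltW.
  apply: le_trans hc1; have := normr_ge0 h.
  have -> : `|h| * c1 = n%:R * (`|q| * `|h|) + delta * (n%:R * `|h|) + `|h| by rewrite /c1; ring.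
  lra.
have small : kappa * delta * dot h h <= alpha * L.
  apply: le_trans hc2.
  apply: (@le_trans _ _ (kappa * delta * (n%:R * `|h|))).
    by rewrite ler_pM2l// mulr_gt0.
  have -> : `|h| * c2 = kappa * delta * (n%:R * `|h|) + `|h| by rewrite /c2; ring.
  by rewrite lerDl.
pose z := w / L.
have zh : `|z| <= 2^-1.
  by rewrite /z normrM normfV (gtr0_norm L0) ler_pdivrMr// mulrC.
(* From [(s - 1/2)^2 >= 0], that is [s <= s^2 + 1/4], with equality at [|x0| = 1/2]. *)
have normle : euclid_norm (x0 + h) <= 2^-1 + 2 * dot x0 h + dot h h.
  rewrite euclid_normE; set D := dot (x0 + h) (x0 + h).
  have DE : D = 4^-1 + 2 * dot x0 h + dot h h by rewrite /D !dotL x00 (dotC h x0); ring.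
  have := sqr_ge0 (Num.sqrt D - 2^-1).
  rewrite sqrrB sqr_sqrtr ?dot_ge0// DE; set s := Num.sqrt _.
  by rewrite -[s * _ *+ 2]mulr_natr => H; lra.
have le1 : dot (x0 + h) e + delta * euclid_norm (x0 + h) <= L * (1 + z).
  have -> : L * (1 + z) = L + w by rewrite /z; field; rewrite gt_eqF.
  have : delta * euclid_norm (x0 + h) <= delta * (2^-1 + 2 * dot x0 h + dot h h).
    by rewrite ler_pM2l.
  by rewrite /w /q /L !dotL (dotC e h); lra.
have z1 : 0 <= 1 + z by move: zh; rewrite ler_norml => /andP[? ?]; lra.
apply: (@le_trans _ _ ((L * (1 + z)) `^ alpha)).
  rewrite /barrier; apply: ge0_ler_powR => //; first exact: ltW.
  - by rewrite nnegrE addr_ge0// mulr_ge0 ?(ltW d0)// euclid_normE sqrtr_ge0.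
  - by rewrite nnegrE mulr_ge0// ltW.
rewrite powRM//; last exact: ltW.
have La : 0 < L `^ alpha by exact: powR_gt0.
apply: (@le_trans _ _ (L `^ alpha * (1 + alpha * z - kappa * z ^+ 2))).
  by rewrite ler_pM2l// hk.
have m0 : 0 < m by rewrite divr_gt0// exprn_gt0.
have mE : L `^ alpha = m * L ^+ 2 by rewrite /m divfK// expf_neq0 ?gt_eqF.
have -> : L `^ alpha * (1 + alpha * z - kappa * z ^+ 2) =
  L `^ alpha + m * (alpha * L * w - kappa * w ^+ 2).
  by rewrite mE /z; field; rewrite gt_eqF.
rewrite -!addrA lerD2l dotZl.
have -> : alpha * L * m * dot q h + m * (2 * alpha * delta * L * dot h h - kappa / 2 * dot q h ^+ 2)
  = m * (alpha * L * dot q h + (2 * alpha * delta * L * dot h h - kappa / 2 * dot q h ^+ 2)) by ring.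
rewrite ler_pM2l//.
have sq : dot q h ^+ 2 / 2 - (delta * dot h h) ^+ 2 <= w ^+ 2.
  have := sqr_ge0 (dot q h + 2 * (delta * dot h h)); rewrite /w.
  have -> : (dot q h + delta * dot h h) ^+ 2 =
    (dot q h + 2 * (delta * dot h h)) ^+ 2 / 2 + dot q h ^+ 2 / 2 - (delta * dot h h) ^+ 2 by field.
  lra.
have sq2 : kappa * (dot q h ^+ 2 / 2 - (delta * dot h h) ^+ 2) <= kappa * w ^+ 2 by rewrite ler_pM2l.
have sm2 : kappa * delta * dot h h * (delta * dot h h) <= alpha * L * (delta * dot h h).
  by rewrite ler_wpM2r// mulr_ge0// ltW.
have -> : alpha * L * w = alpha * L * dot q h + alpha * L * (delta * dot h h) by rewrite /w; ring.
move: sq2 sm2; lra.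
Qed.

End Barrier.

(** * Radial symmetry *)

Section Reflection.
Context {R : realType} {n : nat}.
Implicit Types (x y e h : 'rV[R]_n).

Definition reflection e : 'M[R]_n := 1%:M - (2 / dot e e) *: (e^T *m e).

Lemma mulmx_rank1 x e : x *m (e^T *m e) = dot x e *: e.
Proof. by rewrite mulmxA [x *m e^T]mx11_scalar mul_scalar_mx. Qed.

Lemma qf_rank1 e x : qf (e^T *m e) x = dot e x ^+ 2.
Proof. by rewrite /qf mulmx_rank1 -/(dot _ _) dotZl (dotC x) expr2. Qed.

Lemma sym_rank1 e : (e^T *m e)^T = e^T *m e.
Proof. by rewrite trmx_mul trmxK. Qed.

Lemma norm_rank1 e : `|e| ^+ 2 <= `|e^T *m e|.
Proof.
have [->|e0] := eqVneq e 0; first by rewrite normr0 expr0n.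
have : `|e| != 0 by rewrite normr_eq0.
rewrite {1}/Num.norm /= => /mx_norm_neq0[[i j]] /=.
rewrite (ord1 i) => eE; rewrite [X in X ^+ 2]/Num.norm /= eE -normrX.
have -> : e 0 j ^+ 2 = (e^T *m e) j j.
  by rewrite mxE big_ord1 mxE expr2.
rewrite [leRHS]/Num.norm /= mx_normrE.
by apply/bigmax_geP; right => /=; exists (j, j).
Qed.

Lemma mulmx_reflection x e : x *m reflection e = x - (2 * dot x e / dot e e) *: e.
Proof.
rewrite /reflection mulmxBr mulmx1 -scalemxAr mulmx_rank1 scalerA.
by rewrite mulrAC.
Qed.

Lemma reflection_sym e : (reflection e)^T = reflection e.
Proof. by rewrite /reflection linearB /= linearZ /= trmx1 sym_rank1. Qed.

Lemma reflectionK e : e != 0 -> reflection e *m reflection e = 1%:M.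
Proof.
move=> e0; have ee : dot e e != 0.
  by apply/negP => /eqP /dot_eq0 /eqP; rewrite (negbTE e0).
apply/row_matrixP => i; rewrite !rowE mulmxA !mulmx_reflection mulmx1.
rewrite !dotL; set d := dot _ e.
rewrite -addrA -opprD -scalerDl.
have -> : 2 * d / dot e e + 2 * (d - 2 * d / dot e e * dot e e) / dot e e = 0 by field.
by rewrite scale0r subr0.
Qed.

End Reflection.

Section HalfSphere.
Context {R : realType} {n : nat}.
Implicit Types (x e h : 'rV[R]_n).

Lemma sphere_norm_le x : dot x x = 4^-1 -> `|x| <= 2^-1.
Proof.
move=> xx; rewrite -(@ler_pXn2r _ 2) ?nnegrE// (le_trans (norm_sqr_le _))// xx.
by have -> : 2^-1 ^+ 2 = 4^-1 :> R by field.
Qed.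

Lemma half_sphere_nbhs e x : `|e| <= 1 -> dot x x = 4^-1 -> 0 < dot x e ->
  exists2 r : R, 0 < r &
    forall h, `|h| <= r -> punctured_ball (x + h) /\ 0 <= dot (x + h) e.
Proof.
move=> ne1 xx xe.
have N0 : 0 < n.+1%:R :> R by [].
exists (Num.min (16 * n.+1%:R)^-1 (dot x e / (2 * n.+1%:R))).
  by rewrite lt_min invr_gt0 mulr_gt0//= divr_gt0// mulr_gt0.
have xn := sphere_norm_le xx.
move=> h; rewrite le_min => /andP[h2 h3].
rewrite -[(16 * _)^-1]mul1r ler_pdivlMr ?mulr_gt0// in h2.
rewrite ler_pdivlMr ?mulr_gt0// in h3.
have hN : `|h| * 1 <= `|h| * n.+1%:R by rewrite ler_wpM2l// ler1n.
have nh : n%:R * `|h| <= n.+1%:R * `|h| by rewrite ler_wpM2r// ler_nat.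
have xh : `|dot x h| <= n%:R * `|h|.
  apply: le_trans (dot_le_norm _ _) _; rewrite ler_wpM2l//.
  by rewrite ler_piMl//; lra.
have eh : `|dot h e| <= n%:R * `|h|.
  apply: le_trans (dot_le_norm _ _) _; rewrite ler_wpM2l//.
  by rewrite ler_piMr.
have hh : dot h h <= n%:R * `|h|.
  apply: le_trans (dot_sqr_le _) _; rewrite ler_wpM2l// expr2 ler_piMr//.
  by lra.
have hh0 := dot_ge0 h.
move: xh eh; rewrite !ler_norml => /andP[? ?] /andP[? ?].
split; last by rewrite dotDl; lra.
by rewrite punctured_ballE !dotL xx (dotC h x); apply/andP; split; lra.
Qed.

End HalfSphere.

(** * Comparison of the reflected difference with the barrier *)

Section Symmetry.
Context {R : realType} {n : nat}.
Implicit Types (x y e h : 'rV[R]_n).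
Variables (alpha : R) (F : 'M[R]_n -> R) (u : 'rV[R]_n -> R).
Hypothesis alpha01 : 0 < alpha < 1.
Hypothesis Fell : uniformly_elliptic F.
Hypothesis Fhess : hessian_equation F.
Hypothesis uvisc : viscosity_solution F (@punctured_ball R n) u.
Hypothesis uhom : homogeneous_in_ball alpha u.

Let ucont x : punctured_ball x -> {for x, continuous u}.
Proof.
have op : open (@punctured_ball R n).
  have -> : @punctured_ball R n = (fun x => dot x x) @^-1` `]0, 1[%classic.
    by apply/seteqP; split => y; rewrite /= in_itv /= => /punctured_ballE.
  apply: open_comp; last exact: itv_open.
  by move=> y _; apply: cvg_dot; exact: cvg_id.
have [+ _] := uvisc; rewrite continuous_open_subspace// => h Ox.
exact: (h x (mem_set Ox)).
Qed.

(** At the first contact with the barrier the curvature is negative of order 1 along [q] and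
    positive only of order [delta], which ellipticity excludes for small [delta]. *)
Lemma half_sphere_le e : e != 0 -> dot e e <= 1 -> forall x,
  dot x x = 4^-1 -> 0 <= dot x e -> u x <= u (x *m reflection e).
Proof.
move=> e0 e1 x1 x1x1 x1e; rewrite leNgt; apply/negP => ux1.
have [a0 a1] := andP alpha01.
have [kappa k0 hk] := powR_le_quad alpha01.
have [C C1 [ell pert]] := elliptic_perturb Fell.
have C0 : 0 < C by lra.
have ne0 : 0 < `|e| by rewrite normr_gt0.
have ne1 : `|e| <= 1.
  by rewrite -(@expr_le1 _ 2)// (le_trans (norm_sqr_le _)).
(* The bounds serve in turn [L <= 2], [|q| >= |e|/2] and the final comparison of curvatures. *)
pose delta := Num.min 1 (Num.min (`|e| / 2) (kappa * `|e| ^+ 2 / (64 * C ^+ 2))).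
have d0 : 0 < delta.
  by rewrite !lt_min ltr01 !divr_gt0 ?mulr_gt0 ?exprn_gt0.
have : delta <= delta by [].
rewrite {2}/delta !le_min => /and3P[d1 d2 d3].
move: delta d0 d1 d2 d3 => delta d0 d1 d2 d3.
pose O := reflection e.
have Osym : O^T = O := reflection_sym e.
have Oinv : O *m O = 1%:M := reflectionK e0.
have dotO x : dot (x *m O) (x *m O) = dot x x.
  by rewrite dot_mulmx Osym -mulmxA Oinv mulmx1.
have ballO x : punctured_ball x -> punctured_ball (x *m O).
  by rewrite !punctured_ballE dotO.
have sphere_ball x : dot x x = 4^-1 -> punctured_ball x.
  by move=> h; rewrite punctured_ballE h; lra.
have sphere_norm x : dot x x = 4^-1 -> euclid_norm x = 2^-1.
  move=> h; rewrite euclid_normE h.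
  have -> : 4^-1 = 2^-1 ^+ 2 :> R by field.
  by rewrite sqrtr_sqr ger0_norm.
pose H : set 'rV[R]_n := [set x | dot x x = 4^-1 /\ 0 <= dot x e].
(* The quotient by the barrier, in which [|x| = 1/2] on the sphere; its maximum [M] is the least
   admissible multiple. *)
pose f x := (u x - u (x *m O)) / (dot x e + delta / 2) `^ alpha.
have base_gt0 x : 0 <= dot x e -> 0 < dot x e + delta / 2 by lra.
have cO x : {for x, continuous (fun x => x *m O)}.
  by apply: cvg_mulmx; exact: cvg_id.
have cdot x : {for x, continuous (fun x => dot x e)}.
  by apply: cvg_dot; [exact: cvg_id|exact: cvg_cst].
have Hcpt : compact H.
  apply: (@subclosed_compact _ _ _ _ (@compact_box R n 0 1)).
    have -> : H = ((fun x : 'rV[R]_n => dot x x) @^-1` [set 4^-1]) `&`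
        ((fun x => dot x e) @^-1` [set t | 0 <= t]) by [].
    apply: closedI; apply: closed_comp; [|exact: closed_eq| |exact: closed_ge].
      by move=> x _; apply: cvg_dot; exact: cvg_id.
    by move=> x _; exact: cdot.
  move=> x [xx _] /=; rewrite subr0 -(@expr_le1 _ 2)//.
  by rewrite (le_trans (norm_sqr_le _))// xx; lra.
have fc x : H x -> {for x, continuous f}.
  move=> [xx xe]; apply: cvgM.
    apply: cvgB; first exact: (ucont (sphere_ball _ xx)).
    apply: (@cvg_comp _ _ _ (fun x => x *m O) u) (cO x) _.
    by apply: ucont; apply: ballO; exact: sphere_ball.
  apply: cvgV; first by rewrite gt_eqF// powR_gt0// base_gt0.
  have hb : (fun x => dot x e + delta / 2) @ x --> dot x e + delta / 2.
    by apply: cvgD; [exact: cdot|exact: cvg_cst].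
  apply: (@cvg_comp _ _ _ (fun x => dot x e + delta / 2) (fun t => t `^ alpha)) hb _.
  have dP : derivable ((@powR R) ^~ alpha) (dot x e + delta / 2) 1.
    by apply: derivable_powR; rewrite in_itv /= andbT base_gt0.
  by move/derivable1_diffP/differentiable_continuous : dP.
have [||x0 /set_mem[x0x0 x0e] x0max] := @compact_EVT_max _ R f H _ Hcpt.
- by exists x1.
- by apply: continuous_in_subspaceT => x /set_mem; exact: fc.
pose M := f x0.
have M0 : 0 < M.
  apply: (@lt_le_trans _ _ (f x1)); last by apply: x0max; apply: mem_set.
  by rewrite divr_gt0 ?subr_gt0// powR_gt0// base_gt0.
have HM x : dot x x = 4^-1 -> 0 <= dot x e ->
    u x - u (x *m O) <= M * barrier alpha delta e x.
  move=> xx xe; rewrite /barrier sphere_norm// -ler_pdivrMr ?powR_gt0 ?base_gt0//.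
  by apply: x0max; apply: mem_set.
(* Both sides are homogeneous of order [alpha], so the bound extends from the half-sphere to the
   half-ball. *)
have hom x : punctured_ball x -> 0 <= dot x e ->
    u x - u (x *m O) <= M * barrier alpha delta e x.
  move=> Bx xe; have /andP[xx0 xx1] := (punctured_ballE x).1 Bx.
  pose s := euclid_norm x.
  have s0 : 0 < s by rewrite /s euclid_normE sqrtr_gt0.
  have ss : s ^+ 2 = dot x x by rewrite /s euclid_normE sqr_sqrtr// dot_ge0.
  pose t := (2 * s)^-1.
  have t0 : 0 < t by rewrite invr_gt0 mulr_gt0.
  have txtx : dot (t *: x) (t *: x) = 4^-1.
    by rewrite dotZl dotZr -ss /t; field; rewrite gt_eqF.
  have txe : 0 <= dot (t *: x) e by rewrite dotZl mulr_ge0// ltW.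
  have := HM _ txtx txe; rewrite -scalemxAl.
  have Btx := sphere_ball _ txtx.
  rewrite (uhom t0 Bx Btx) (uhom t0 (ballO _ Bx)); last by rewrite scalemxAl; exact: ballO.
  have -> : barrier alpha delta e (t *: x) = t `^ alpha * barrier alpha delta e x.
    rewrite /barrier -powRM ?(ltW t0)//; last first.
      by rewrite addr_ge0// mulr_ge0 ?(ltW d0)// euclid_normE sqrtr_ge0.
    congr (_ `^ _); rewrite dotZl sphere_norm// mulrDr; congr (_ + _).
    by rewrite -/s /t; field; rewrite gt_eqF.
  by rewrite -mulrBr mulrCA ler_pM2l// powR_gt0.
have MbE : u x0 - u (x0 *m O) = M * barrier alpha delta e x0.
  by rewrite /M /f /barrier sphere_norm// divfK// gt_eqF// powR_gt0// base_gt0.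
(* On the hyperplane the reflected difference vanishes while the barrier is positive. *)
have x0e_gt : 0 < dot x0 e.
  rewrite lt_neqAle x0e andbT; apply/negP => /eqP x0e0.
  have b0 : 0 < M * barrier alpha delta e x0.
    by rewrite mulr_gt0// powR_gt0// sphere_norm// base_gt0.
  by move: b0; rewrite -MbE mulmx_reflection -x0e0 mulr0 mul0r scale0r subr0 subrr ltxx.
have := barrier_le a0 k0 hk d0 x0x0 x0e.
set L := dot x0 e + delta / 2; set q := e + (2 * delta) *: x0.
set m := L `^ alpha / L ^+ 2.
move=> /= [r r0 hr].
have L0 : 0 < L by exact: base_gt0.
have m0 : 0 < m by rewrite divr_gt0 ?powR_gt0 ?exprn_gt0.
have Mm0 : 0 < M * m by rewrite mulr_gt0.
have [r1 r10 hr1] := half_sphere_nbhs ne1 x0x0 x0e_gt.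
pose r' := Num.min r r1.
have r'0 : 0 < r' by rewrite lt_min r0.
have small h : `|h| <= r' -> [/\ `|h| <= r, punctured_ball (x0 + h) & 0 <= dot (x0 + h) e].
  by rewrite le_min => /andP[h1 /hr1[]].
have x0n := sphere_norm_le x0x0.
(* The bound of [barrier_le] times [M] contributes 4 to the coefficient 6; the remaining 2 is the
   slack that makes the contact strict. *)
pose S : 'M[R]_n := (6 * (M * m) * alpha * delta * L)%:M - (M * m * kappa) *: (q^T *m q).
have sS : S^T = S.
  by rewrite /S linearB /= linearZ /= tr_scalar_mx sym_rank1.
have qS h : qf S h = 6 * (M * m) * alpha * delta * L * dot h h - M * m * kappa * dot q h ^+ 2.
  by rewrite /S qfDl qfNl qfZl qf_rank1 -scalemx1 qfZl qf1.
have eta0 : 0 < M * m * alpha * delta * L := mulr_gt0 (mulr_gt0 (mulr_gt0 Mm0 a0) d0) L0.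
have balls h : `|h| <= r' -> punctured_ball (x0 + h) /\ punctured_ball ((x0 + h) *m O).
  by move=> /small[_ hb _]; split => //; exact: ballO.
have touch h : `|h| <= r' -> u (x0 + h) - u ((x0 + h) *m O) <=
    u x0 - u (x0 *m O) + dot ((M * (alpha * L * m)) *: q) h + 2^-1 * qf S h -
    M * m * alpha * delta * L * dot h h.
  move=> /small[h1 h2 h3]; apply: le_trans (hom _ h2 h3) _.
  have := hr h h1 h3; rewrite -(ler_pM2l M0) => h4; apply: le_trans h4 _.
  rewrite MbE /barrier sphere_norm// -/L qS !dotZl.
  rewrite le_eqVlt; apply/orP; left; apply/eqP.
  by rewrite -/m; field.
have [B [sB FB FBS]] := reflected_difference_touch Fell Fhess uvisc Osym Oinv r'0 eta0 sS
  ucont balls touch.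
(* From [X] one reaches [B] by adding the rank-one part, and [B + S] by adding the small multiple of
   the identity. Ellipticity at [X] weighs the two against each other. *)
pose X := B - (M * m * kappa) *: (q^T *m q).
have sX : X^T = X by rewrite /X linearB /= linearZ /= sB sym_rank1.
have a00 : 0 < M * m * kappa by rewrite mulr_gt0.
have hN : nonneg_definite ((M * m * kappa) *: (q^T *m q)).
  split; first by rewrite linearZ /= sym_rank1.
  by move=> v; rewrite -/(qf _ _) qfZl qf_rank1 mulr_ge0 ?sqr_ge0// ltW.
have h1 := ell _ _ sX hN.
have h2 := pert X (6 * (M * m) * alpha * delta * L) sX _.
rewrite /X subrK in h1.
have BS : B + S = X + (6 * (M * m) * alpha * delta * L)%:M.
  by rewrite /S /X addrA addrAC.
rewrite BS in FBS.
rewrite normrZ (gtr0_norm a00) in h1.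
have qe : `|e| / 2 <= `|q|.
  have : `|e| <= `|q| + `|(2 * delta) *: x0| by rewrite -{1}(addrK ((2 * delta) *: x0) e) ler_normB.
  rewrite normrZ gtr0_norm ?mulr_gt0// => h3.
  have : 2 * delta * `|x0| <= 2 * delta * 2^-1 by rewrite ler_pM2l// mulr_gt0.
  by lra.
have L2 : L <= 2.
  have := dot_ge0 (x0 - e); rewrite !dotL x0x0 (dotC e x0) => h3.
  by rewrite /L; lra.
have b0 : 0 <= 6 * (M * m) * alpha * delta * L.
  have -> : 6 * (M * m) * alpha * delta * L = 6 * (M * m * alpha * delta * L) by ring.
  by rewrite mulr_ge0// ltW.
have {}h2 := h2 b0.
have h3 : C^-1 * (M * m * kappa * `|q^T *m q|) <= C * (6 * (M * m) * alpha * delta * L) by lra.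
rewrite ler_pdivrMl// in h3.
have h4 : M * m * (kappa * `|q^T *m q|) <= M * m * (C * (C * (6 * alpha * delta * L))).
  apply: le_trans (le_trans _ h3) _; rewrite le_eqVlt; apply/orP; left; apply/eqP; ring.
rewrite ler_pM2l// in h4.
have q2 : `|e| ^+ 2 / 4 <= `|q^T *m q|.
  apply: le_trans (norm_rank1 q).
  have -> : `|e| ^+ 2 / 4 = (`|e| / 2) ^+ 2 by field.
  by rewrite ler_pXn2r ?nnegrE// divr_ge0.
have h5 : kappa * (`|e| ^+ 2 / 4) <= kappa * `|q^T *m q| by rewrite ler_pM2l.
have C2 : 0 < C ^+ 2 by rewrite exprn_gt0.
have h6 : 12 * C ^+ 2 * delta <= 12 / 64 * (kappa * `|e| ^+ 2).
  have := d3; rewrite ler_pdivlMr ?mulr_gt0// => h6; lra.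
have aL : alpha * L <= 2.
  apply: le_trans L2; rewrite ler_piMl//; exact: ltW.
have h7 : C * (C * (6 * alpha * delta * L)) <= 12 * C ^+ 2 * delta.
  have -> : C * (C * (6 * alpha * delta * L)) = 6 * C ^+ 2 * delta * (alpha * L) by ring.
  have -> : 12 * C ^+ 2 * delta = 6 * C ^+ 2 * delta * 2 by ring.
  by rewrite ler_pM2l// !mulr_gt0.
have ke : 0 < kappa * `|e| ^+ 2 by rewrite mulr_gt0// exprn_gt0.
(* The estimates combine to [kappa |e|^2 / 4 <= (12/64) kappa |e|^2], which is impossible. *)
lra.
Qed.

(** The reflection along [a - b] exchanges two points [a], [b] of the sphere, and [|a - b| <= 1]
    since the radius is 1/2. *)
Lemma sphere_constant x y : dot x x = 4^-1 -> dot y y = 4^-1 -> u x = u y.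
Proof.
suff H a b : dot a a = 4^-1 -> dot b b = 4^-1 -> u a <= u b.
  by move=> xx yy; apply/eqP; rewrite eq_le !H.
move=> aa bb; have [->|ab] := eqVneq a b; first exact: lexx.
have e0 : a - b != 0 by rewrite subr_eq0.
have ab0 := dot_ge0 (a - b); have ab1 := dot_ge0 (a + b).
rewrite !dotL aa bb (dotC b a) in ab0 ab1.
have e1 : dot (a - b) (a - b) <= 1 by rewrite !dotL aa bb (dotC b a); lra.
have ae : 0 <= dot a (a - b) by rewrite !dotL aa; lra.
have := half_sphere_le e0 e1 aa ae.
rewrite mulmx_reflection.
have -> : 2 * dot a (a - b) / dot (a - b) (a - b) = 1.
  have ee : dot (a - b) (a - b) != 0.
    by apply/negP => /eqP /dot_eq0 /eqP; rewrite (negbTE e0).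
  have -> : 2 * dot a (a - b) = dot (a - b) (a - b).
    by rewrite !dotL aa bb (dotC b a); ring.
  by rewrite divff.
by rewrite scale1r opprB addrC subrK.
Qed.

End Symmetry.

Unset Implicit Arguments.

Theorem corollary1p3 (R : realType) (n : nat) (alpha : R)
    (F : 'M[R]_n -> R) (u : 'rV[R]_n -> R) :
  (2 <= n)%N ->
  0 < alpha < 1 ->
  [lipschitz F S | S in @symmetric_matrices R n] ->
  uniformly_elliptic F ->
  hessian_equation F ->
  viscosity_solution F (@punctured_ball R n) u ->
  homogeneous_in_ball alpha u ->
  exists c : R, forall x : 'rV[R]_n, punctured_ball x ->
    u x = c * euclid_norm x `^ alpha.
Proof.
move=> n2 a01 _ Fell Fhess uvisc uhom.
pose z : 'rV[R]_n := 2^-1 *: delta_mx 0 (Ordinal (ltnW n2)).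
have zz : dot z z = 4^-1.
  by rewrite dotZl dotZr dot_delta_delta; field.
(* The factor [2^alpha] compensates for [|z| = 1/2]. *)
exists (2 `^ alpha * u z) => x Bx; have /andP[x0 x1] := (punctured_ballE x).1 Bx.
pose s := euclid_norm x.
have s0 : 0 < s by rewrite /s euclid_normE sqrtr_gt0.
have ss : s ^+ 2 = dot x x by rewrite /s euclid_normE sqr_sqrtr// dot_ge0.
have s20 : 0 < 2 * s by rewrite mulr_gt0.
pose y := (2 * s)^-1 *: x.
have yy : dot y y = 4^-1.
  by rewrite dotZl dotZr -ss; field; rewrite gt_eqF.
have xE : x = (2 * s) *: y by rewrite scalerA divff ?gt_eqF// scale1r.
have By : punctured_ball y by rewrite punctured_ballE yy; lra.
rewrite {1}xE (uhom _ _ s20 By); last by rewrite -xE.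
rewrite (sphere_constant a01 Fell Fhess uvisc uhom yy zz).
by rewrite powRM ?(ltW s0)// mulrAC.
Qed.
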